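(* Let $x:[0,1]^2\to\mathbb{R}^3$ be a (smooth, regular, generic) parametrized surface patch such that for all $u_0<u_1$ and $v_0<v_1$ in $[0,1]$ the four points $x(u_0,v_0),x(u_1,v_0),x(u_1,v_1),x(u_0,v_1)$ lie on a common circle. Then the parameter lines of $x$ are principal curvature lines, and the patch is the image under a Möbius transformation of (a piece of) a surface of revolution, a cone, or a cylinder. Furthermore, every two principal curvature lines of the same family ($u\mapsto x(u,v_0)$ and $u\mapsto x(u,v_1)$, resp. $v\mapsto x(u_0,v)$ and $v\mapsto x(u_1,v)$) are mapped onto each other by an inversion in a sphere.
   Context: Here cone and cylinder are meant in the generalized sense (a union of lines through a common point, resp. of parallel lines), as arising from the classification of multi-circular nets as Möbius images of nets generated by reflections in planes through an axis and spheres centered on it (revolution), in concentric spheres and planes through their center (cone), or in parallel planes and planes orthogonal to them (cylinder). *)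

(* Defs.v *)
From Stdlib Require Export Reals List ClassicalEpsilon.
Open Scope R_scope.

Record R3 := mkR3 { c1 : R; c2 : R; c3 : R }.

Definition vzero : R3 := mkR3 0 0 0.
Definition vadd (a b : R3) : R3 := mkR3 (c1 a + c1 b) (c2 a + c2 b) (c3 a + c3 b).
Definition vscale (k : R) (a : R3) : R3 := mkR3 (k * c1 a) (k * c2 a) (k * c3 a).
Definition vsub (a b : R3) : R3 := vadd a (vscale (-1) b).
Definition dot (a b : R3) : R := c1 a * c1 b + c2 a * c2 b + c3 a * c3 b.
Definition cross (a b : R3) : R3 :=
  mkR3 (c2 a * c3 b - c3 a * c2 b) (c3 a * c1 b - c1 a * c3 b) (c1 a * c2 b - c2 a * c1 b).
Definition vnorm (a : R3) : R := sqrt (dot a a).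

Definition vderiv_lim (f : R -> R3) (t : R) (l : R3) : Prop :=
  derivable_pt_lim (fun s => c1 (f s)) t (c1 l) /\
  derivable_pt_lim (fun s => c2 (f s)) t (c2 l) /\
  derivable_pt_lim (fun s => c3 (f s)) t (c3 l).

Definition continuous2 (f : R -> R -> R) : Prop :=
  forall u v eps, 0 < eps -> exists delta, 0 < delta /\
    forall u' v', Rabs (u' - u) < delta -> Rabs (v' - v) < delta ->
      Rabs (f u' v' - f u v) < eps.

Definition smooth2 (f : R -> R -> R) : Prop :=
  exists D : nat -> nat -> R -> R -> R,
    (forall u v, D O O u v = f u v) /\
    forall i j, continuous2 (D i j) /\
      forall u v, derivable_pt_lim (fun s => D i j s v) u (D (S i) j u v) /\
                  derivable_pt_lim (fun t => D i j u t) v (D i (S j) u v).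

Definition smooth_surface (x : R -> R -> R3) : Prop :=
  smooth2 (fun u v => c1 (x u v)) /\ smooth2 (fun u v => c2 (x u v)) /\
  smooth2 (fun u v => c3 (x u v)).

Definition smooth1 (f : R -> R) : Prop :=
  exists D : nat -> R -> R, (forall t, D O t = f t) /\
    forall n t, derivable_pt_lim (D n) t (D (S n) t).

Definition smooth_curve (g : R -> R3) : Prop :=
  smooth1 (fun s => c1 (g s)) /\ smooth1 (fun s => c2 (g s)) /\ smooth1 (fun s => c3 (g s)).

Definition regular_curve (g : R -> R3) : Prop :=
  forall s l, vderiv_lim g s l -> l <> vzero.

(** partial derivatives x_u, x_v (the unique derivative when it exists) *)
Definition pdu (x : R -> R -> R3) (u v : R) : R3 :=
  epsilon (inhabits vzero) (fun l => vderiv_lim (fun s => x s v) u l).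
Definition pdv (x : R -> R -> R3) (u v : R) : R3 :=
  epsilon (inhabits vzero) (fun l => vderiv_lim (fun t => x u t) v l).

Definition in_square (u v : R) : Prop := 0 <= u <= 1 /\ 0 <= v <= 1.

Definition regular_at (x : R -> R -> R3) (u v : R) : Prop :=
  cross (pdu x u v) (pdv x u v) <> vzero.

Definition unit_normal (x : R -> R -> R3) (u v : R) : R3 :=
  let w := cross (pdu x u v) (pdv x u v) in vscale (/ vnorm w) w.

(** x_u (resp. x_v) is a principal direction at (u,v): it is an eigenvector of
    the shape operator, i.e. (Rodrigues) n_u = k x_u (resp. n_v = k x_v). *)
Definition u_principal (x : R -> R -> R3) (u v : R) : Prop :=
  exists k, vderiv_lim (fun s => unit_normal x s v) u (vscale k (pdu x u v)).
Definition v_principal (x : R -> R -> R3) (u v : R) : Prop :=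
  exists k, vderiv_lim (fun t => unit_normal x u t) v (vscale k (pdv x u v)).

Definition umbilic (x : R -> R -> R3) (u v : R) : Prop :=
  exists k, vderiv_lim (fun s => unit_normal x s v) u (vscale k (pdu x u v)) /\
            vderiv_lim (fun t => unit_normal x u t) v (vscale k (pdv x u v)).

Definition generic_patch (x : R -> R -> R3) : Prop :=
  (forall u v u' v', in_square u v -> in_square u' v' -> x u v = x u' v' ->
     u = u' /\ v = v') /\
  (forall u v, in_square u v -> ~ umbilic x u v).

(** * Circles (in the Moebius sense: round circles or straight lines) *)
Definition is_circle (c e1 e2 : R3) (r : R) : Prop :=
  0 < r /\ dot e1 e1 = 1 /\ dot e2 e2 = 1 /\ dot e1 e2 = 0.
Definition on_circle (c e1 e2 : R3) (r : R) (p : R3) : Prop :=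
  exists t, p = vadd c (vadd (vscale (r * cos t) e1) (vscale (r * sin t) e2)).
Definition on_line (a d p : R3) : Prop := exists t, p = vadd a (vscale t d).

Definition concyclic4 (p1 p2 p3 p4 : R3) : Prop :=
  (exists c e1 e2 r, is_circle c e1 e2 r /\
     on_circle c e1 e2 r p1 /\ on_circle c e1 e2 r p2 /\
     on_circle c e1 e2 r p3 /\ on_circle c e1 e2 r p4) \/
  (exists a d, d <> vzero /\ on_line a d p1 /\ on_line a d p2 /\
     on_line a d p3 /\ on_line a d p4).

Inductive gsphere : Type :=
| SphInv (c : R3) (r : R)
| PlaneRefl (n : R3) (d : R).

Definition valid_gs (g : gsphere) : Prop :=
  match g with SphInv _ r => 0 < r | PlaneRefl n _ => dot n n = 1 end.

Definition gs_defined (g : gsphere) (y : R3) : Prop :=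
  match g with SphInv c _ => y <> c | PlaneRefl _ _ => True end.

Definition gs_apply (g : gsphere) (y : R3) : R3 :=
  match g with
  | SphInv c r => vadd c (vscale (r ^ 2 / dot (vsub y c) (vsub y c)) (vsub y c))
  | PlaneRefl n d => vsub y (vscale (2 * (dot n y - d)) n)
  end.

(** A Moebius transformation = finite composition of inversions in generalized
    spheres; [mob_maps l y z]: it is defined at y and sends y to z. *)
Definition mobius (l : list gsphere) : Prop := Forall valid_gs l.

Fixpoint mob_maps (l : list gsphere) (y z : R3) : Prop :=
  match l with
  | nil => z = y
  | g :: l' => gs_defined g y /\ mob_maps l' (gs_apply g y) z
  end.

(** rotation by angle th about the unit vector a (Rodrigues) *)
Definition rotate (a : R3) (th : R) (w : R3) : R3 :=
  vadd (vscale (cos th) w)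
       (vadd (vscale (sin th) (cross a w)) (vscale ((1 - cos th) * dot a w) a)).

Definition surface_of_revolution (S : R3 -> Prop) : Prop :=
  exists (p a : R3) (g : R -> R3), dot a a = 1 /\ smooth_curve g /\ regular_curve g /\
    forall y, S y <-> exists th s, y = vadd p (rotate a th (vsub (g s) p)).

Definition gen_cone (S : R3 -> Prop) : Prop :=
  exists (p : R3) (w : R -> R3), smooth_curve w /\ regular_curve w /\
    forall y, S y <-> exists s t, y = vadd p (vscale t (w s)).

Definition gen_cylinder (S : R3 -> Prop) : Prop :=
  exists (d : R3) (g : R -> R3), d <> vzero /\ smooth_curve g /\ regular_curve g /\
    forall y, S y <-> exists s t, y = vadd (g s) (vscale t d).

(* Main.v *)
(** Invert the patch at a corner [x(u0,v0)]. Circles through that corner become lines,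
    so [y(u,v)] lies on the segment from [a(u) = y(u,v0)] to [b(v) = y(u0,v)]; comparing
    the powers of the point [b(v)] with respect to the circles through [a(u), y(u,v)] for
    different [u] shows that [(y-b).(a-b)] depends on [v] only. Hence [y(.,v)] is the
    inverse of [a] in a sphere centered at [b(v)], and undoing the inversion gives the
    spheres relating two parameter lines.

    By symmetry [(y-a).(b-a)] depends on [u] only, so [|a(u)-b(v)|^2] is a function of [u]
    plus a function of [v], and all differences of values of [a] are orthogonal to those of
    [b]. One of the two, say [a], runs in a line and the other in an orthogonal plane, and
    [y(u,.)] is the inverse of [b] in a sphere of a fixed pencil with centers on the line.
    An elliptic, hyperbolic or parabolic pencil is sent by an inversion to the planes
    through an axis, concentric spheres or parallel planes, and the patch to a piece of a
    surface of revolution, a cone or a cylinder.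

    Letting the circular quadrilaterals shrink gives [x_u.x_v = 0] and
    [det(x_u, x_v, x_uv) = 0], i.e. the parameter lines are curvature lines. *)
From Stdlib Require Import Reals List ClassicalEpsilon FunctionalExtensionality Psatz Ranalysis5.
From Coquelicot Require Import Coquelicot.
(* [Defs] comes last because [Reals] has another [c1]. *)
Require Import Defs.
Open Scope R_scope.

(** Three obstacles shape the proof. Powers can be compared only where the inverted points are not
    collinear; [ipow_const] removes the collinear positions by continuity, since an open set of them
    would force a piece of the patch onto a circle or line, against regularity. Next, inversion in a
    real sphere needs a positive power, and constancy of the power leaves its sign open; the sign is
    found near the corner, where [b(v)] escapes to infinity. Finally, the corner has no finite image
    under the first inversion, although the whole closed square has to be mapped. Hence the
    inversion at the corner, a translation and the same inversion are merged into one special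
    conformal map [sct q] that fixes the corner; its pole [q] is a distinguished point of the pencil
    (limit point, point of tangency or common point) which the inverted patch avoids. Identities are
    proved for 0 < u and 0 < v and reach the other two edges by continuity. The model curves must be
    smooth and regular on the whole real line, although regularity is given only on the square; an
    arctangent reparametrization confines them to a neighbourhood of [0,1]. *)

Ltac vunfold := unfold vsub, vadd, vscale, dot, cross, vzero in *; simpl in *.

(** * Vector algebra and the inversion in the unit sphere *)

Lemma R3_ext (a b : R3) : c1 a = c1 b -> c2 a = c2 b -> c3 a = c3 b -> a = b.
Proof. destruct a, b; simpl; intros; subst; reflexivity. Qed.

Ltac vring := intros; apply R3_ext; vunfold; ring.
Ltac dring := intros; vunfold; ring.

Lemma dot_self_ge0 (a : R3) : 0 <= dot a a.
Proof. vunfold; nra. Qed.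

Lemma dot_self_eq0 (a : R3) : dot a a = 0 -> a = vzero.
Proof. intros H; apply R3_ext; vunfold; nra. Qed.

Lemma dot_self_pos (a : R3) : a <> vzero -> 0 < dot a a.
Proof.
intros H; destruct (Rle_lt_or_eq_dec _ _ (dot_self_ge0 a)) as [|E]; auto.
now elim H; apply dot_self_eq0.
Qed.

Lemma dot_pos_neq0 (a : R3) : 0 < dot a a -> a <> vzero.
Proof. intros H ->; vunfold; lra. Qed.

Lemma vsub_neq0 (a b : R3) : a <> b -> vsub a b <> vzero.
Proof.
intros H E; apply H; apply R3_ext;
  [apply (f_equal c1) in E | apply (f_equal c2) in E | apply (f_equal c3) in E];
  vunfold; lra.
Qed.

Lemma cross_eq0_parallel (w d : R3) :
  cross w d = vzero -> d <> vzero -> w = vscale (dot w d / dot d d) d.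
Proof.
intros H Hd; apply dot_self_pos in Hd.
assert (K : vscale (dot d d) w = vscale (dot w d) d).
{ assert (E : vsub (vscale (dot d d) w) (vscale (dot w d) d) = cross d (cross w d)) by vring.
  rewrite H in E.
  apply R3_ext; [apply (f_equal c1) in E | apply (f_equal c2) in E | apply (f_equal c3) in E];
    vunfold; lra. }
apply (f_equal (vscale (/ dot d d))) in K.
transitivity (vscale (/ dot d d) (vscale (dot d d) w)).
- apply R3_ext; simpl; field; lra.
- rewrite K; apply R3_ext; simpl; field; lra.
Qed.

(** Both [d1] and [d2] are multiples of [cross n1 n2]. This is the dimension count behind every
    collinearity statement below. *)
Lemma cross_eq0_of_perp (n1 n2 d1 d2 : R3) : cross n1 n2 <> vzero ->
  dot n1 d1 = 0 -> dot n2 d1 = 0 -> dot n1 d2 = 0 -> dot n2 d2 = 0 ->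
  cross d1 d2 = vzero.
Proof.
intros Hn H11 H21 H12 H22.
assert (K : forall d, dot n1 d = 0 -> dot n2 d = 0 -> cross d (cross n1 n2) = vzero).
{ intros d E1 E2.
  assert (E : cross d (cross n1 n2) = vsub (vscale (dot n2 d) n1) (vscale (dot n1 d) n2)) by vring.
  rewrite E, E1, E2; vring. }
rewrite (cross_eq0_parallel d1 _ (K d1 H11 H21) Hn).
rewrite (cross_eq0_parallel d2 _ (K d2 H12 H22) Hn).
vring.
Qed.

Lemma exists_perp (d : R3) : exists n, dot n d = 0 /\ n <> vzero.
Proof.
destruct (classic (c1 d = 0 /\ c2 d = 0)) as [[E1 E2] | Hne].
- exists (mkR3 1 0 0); split; [unfold dot; simpl; lra|].
  intros F; apply (f_equal c1) in F; simpl in F; lra.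
- exists (mkR3 (c2 d) (- c1 d) 0); split; [unfold dot; simpl; lra|].
  intros F; apply Hne; pose proof (f_equal c1 F) as F1; pose proof (f_equal c2 F) as F2.
  simpl in F1, F2; lra.
Qed.

(** Inversion in the unit sphere about the origin. The centre gets the default value [vzero], so a
    point sent to infinity has to be excluded or treated separately. *)
Definition inv0 (d : R3) : R3 := vscale (/ dot d d) d.

Lemma dot_inv0_l (n d : R3) : dot n (inv0 d) = dot n d / dot d d.
Proof. unfold inv0, Rdiv; dring. Qed.

Lemma inv0_norm (d : R3) : d <> vzero -> dot (inv0 d) (inv0 d) = / dot d d.
Proof.
intros H; apply dot_self_pos in H.
assert (E : dot (inv0 d) (inv0 d) = / dot d d * / dot d d * dot d d) by (unfold inv0; dring).
rewrite E; field; lra.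
Qed.

Lemma inv0_neq0 (d : R3) : d <> vzero -> inv0 d <> vzero.
Proof.
intros H; apply dot_pos_neq0; rewrite inv0_norm by exact H.
apply Rinv_0_lt_compat, dot_self_pos, H.
Qed.

Lemma inv0_inv0 (d : R3) : d <> vzero -> inv0 (inv0 d) = d.
Proof.
intros H; unfold inv0 at 1; rewrite inv0_norm by exact H; unfold inv0.
apply dot_self_pos in H.
apply R3_ext; simpl; field; lra.
Qed.

Lemma inv0_inj (d d' : R3) : d <> vzero -> d' <> vzero -> inv0 d = inv0 d' -> d = d'.
Proof. intros H H' E; rewrite <- (inv0_inv0 d), <- (inv0_inv0 d'), E; auto. Qed.

(** * Circles as intersections of a sphere and a plane *)

Lemma on_circle_eqs (c e1 e2 : R3) (r : R) (p : R3) :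
  is_circle c e1 e2 r -> on_circle c e1 e2 r p ->
  dot (vsub p c) (vsub p c) = r ^ 2 /\ dot (cross e1 e2) (vsub p c) = 0.
Proof.
intros (Hr & H11 & H22 & H12) (t & ->).
pose proof (sin2_cos2 t) as T; unfold Rsqr in T.
split.
- transitivity (r ^ 2 * ((cos t * cos t) * dot e1 e1 + (sin t * sin t) * dot e2 e2
     + 2 * cos t * sin t * dot e1 e2)); [dring|].
  rewrite H11, H22, H12; transitivity (r ^ 2 * (sin t * sin t + cos t * cos t)); [ring|].
  rewrite T; ring.
- dring.
Qed.

Lemma circle_normal (c e1 e2 : R3) (r : R) :
  is_circle c e1 e2 r -> dot (cross e1 e2) (cross e1 e2) = 1.
Proof.
intros (Hr & H11 & H22 & H12).
transitivity (dot e1 e1 * dot e2 e2 - dot e1 e2 ^ 2); [dring|].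
rewrite H11, H22, H12; ring.
Qed.

(** The points satisfy a sphere equation [k |p|^2 + m.p + s = 0] and a plane equation,
    independent at least when both pass through [o]. Coordinates are relative to [o], so
    that passing to [inv0 (p - o)] exchanges [k] and [s]. *)
Lemma concyclic4_eqs (o p1 p2 p3 p4 : R3) : concyclic4 p1 p2 p3 p4 ->
  exists k m s m' s',
  (forall p, p = p1 \/ p = p2 \/ p = p3 \/ p = p4 ->
    k * dot (vsub p o) (vsub p o) + dot m (vsub p o) + s = 0 /\
    dot m' (vsub p o) + s' = 0) /\
  (s = 0 -> s' = 0 -> cross m m' <> vzero).
Proof.
intros [(c & e1 & e2 & r & Hc & H1 & H2 & H3 & H4) | (a & d & Hd & H1 & H2 & H3 & H4)].
- pose proof (circle_normal _ _ _ _ Hc) as Hn.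
  exists 1, (vscale 2 (vsub o c)), (dot (vsub o c) (vsub o c) - r ^ 2),
    (cross e1 e2), (dot (cross e1 e2) (vsub o c)); split.
  + assert (K : forall p, on_circle c e1 e2 r p ->
      1 * dot (vsub p o) (vsub p o) + dot (vscale 2 (vsub o c)) (vsub p o)
       + (dot (vsub o c) (vsub o c) - r ^ 2) = 0 /\
      dot (cross e1 e2) (vsub p o) + dot (cross e1 e2) (vsub o c) = 0).
    { intros p Hp; destruct (on_circle_eqs _ _ _ _ _ Hc Hp) as [E1 E2]; split.
      - rewrite <- E1; dring.
      - rewrite <- E2; dring. }
    intros p [-> | [-> | [-> | ->]]]; auto.
  (* With [o] on the circle, [m] is radial and [m'] is normal to the plane of the circle, so they
     are nonzero and orthogonal. *)
  + intros E1 E2; apply dot_pos_neq0.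
    set (n := cross e1 e2) in *; set (w := vsub o c) in *.
    assert (E : dot (cross (vscale 2 w) n) (cross (vscale 2 w) n)
       = 4 * (dot w w * dot n n - dot n w ^ 2)) by dring.
    rewrite E, Hn, E2; destruct Hc as [Hr _]; nra.
- (* off the line, one plane through the line that misses [o] is enough *)
  set (w := vsub o a).
  assert (Dp := dot_self_pos d Hd).
  (* [n1] is the part of [w] orthogonal to the line, up to a factor. It vanishes exactly when [o] is
     on the line, and then two orthogonal planes through the line are taken. *)
  set (n1 := vsub (vscale (dot d d) w) (vscale (dot w d) d)).
  assert (n1d : dot n1 d = 0) by (unfold n1; dring).
  assert (C : exists m m', dot m d = 0 /\ dot m' d = 0 /\
      (dot m w = 0 -> dot m' w = 0 -> cross m m' <> vzero)).
  { destruct (excluded_middle_informative (n1 = vzero)) as [E | E].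
    - destruct (exists_perp d) as (n & Hnd & Hn0); exists n, (cross n d); repeat split; auto.
      + dring.
      + intros _ _; apply dot_pos_neq0.
        assert (EE : dot (cross n (cross n d)) (cross n (cross n d))
          = dot n n * (dot n n * dot d d - dot n d ^ 2)) by dring.
        rewrite EE, Hnd; pose proof (dot_self_pos n Hn0).
        apply Rmult_lt_0_compat; [assumption | ].
        apply Rlt_le_trans with (dot n n * dot d d); [ | lra].
        now apply Rmult_lt_0_compat.
    - exists n1, vzero; repeat split; auto.
      + unfold vzero; dring.
      + intros F _; elim E; apply dot_self_eq0.
        assert (EE : dot n1 n1 = dot d d * dot n1 w - dot w d * dot n1 d)
          by (unfold n1; dring).
        rewrite EE, F, n1d; ring. }
  destruct C as (m & m' & M & M' & I).
  exists 0, m, (dot m w), m', (dot m' w); split.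
  + assert (K : forall p, on_line a d p ->
       0 * dot (vsub p o) (vsub p o) + dot m (vsub p o) + dot m w = 0 /\
       dot m' (vsub p o) + dot m' w = 0).
    { intros p (t & ->); unfold w; split.
      - transitivity (t * dot m d); [dring | rewrite M; ring].
      - transitivity (t * dot m' d); [dring | rewrite M'; ring]. }
    intros p [-> | [-> | [-> | ->]]]; auto.
  + exact I.
Qed.

(** A circle through the centre has [s = s' = 0]. Its inverse lies in the planes m.y = -k and m'.y =
    0, which are not parallel because [m] and [m'] are independent. *)
Lemma concyclic4_inv_collinear (p1 p2 p3 p4 : R3) : concyclic4 p1 p2 p3 p4 ->
  p2 <> p1 -> p3 <> p1 -> p4 <> p1 ->
  cross (vsub (inv0 (vsub p3 p1)) (inv0 (vsub p2 p1)))
        (vsub (inv0 (vsub p4 p1)) (inv0 (vsub p2 p1))) = vzero.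
Proof.
intros H H2 H3 H4.
destruct (concyclic4_eqs p1 _ _ _ _ H) as (k & m & s & m' & s' & E & I).
assert (S0 : s = 0 /\ s' = 0).
{ destruct (E p1 (or_introl eq_refl)) as [E1 E2].
  vunfold; split; ring_simplify in E1; ring_simplify in E2; lra. }
destruct S0 as [Es Es'].
assert (K : forall p, p = p1 \/ p = p2 \/ p = p3 \/ p = p4 -> p <> p1 ->
   dot m (inv0 (vsub p p1)) = - k /\ dot m' (inv0 (vsub p p1)) = 0).
{ intros p Hp Hne; destruct (E p Hp) as [E1 E2].
  pose proof (dot_self_pos _ (vsub_neq0 _ _ Hne)) as P.
  rewrite !dot_inv0_l; set (q := vsub p p1) in *; split.
  - replace (dot m q) with (- k * dot q q) by lra; field; lra.
  - replace (dot m' q) with 0 by lra; field; lra. }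
destruct (K p2) as [A2 B2]; auto; destruct (K p3) as [A3 B3]; auto.
destruct (K p4) as [A4 B4]; auto.
assert (L : forall n a b, dot n (vsub a b) = dot n a - dot n b) by dring.
apply (cross_eq0_of_perp m m'); auto; rewrite L; lra.
Qed.

(** The images are not collinear, so [s] and [s'] are not both zero, and the sphere or the plane
    inverts to a sphere. Its equation is normalized to leading coefficient 1, the form from which
    powers of points are read off. *)
Lemma concyclic4_inv_sphere (o p1 p2 p3 p4 : R3) : concyclic4 p1 p2 p3 p4 ->
  p1 <> o -> p2 <> o -> p3 <> o -> p4 <> o ->
  let y1 := inv0 (vsub p1 o) in let y2 := inv0 (vsub p2 o) in
  let y3 := inv0 (vsub p3 o) in let y4 := inv0 (vsub p4 o) in
  cross (vsub y2 y1) (vsub y4 y1) <> vzero ->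
  exists m s, forall y, y = y1 \/ y = y2 \/ y = y3 \/ y = y4 ->
    dot y y + dot m y + s = 0.
Proof.
intros H H1 H2 H3 H4 y1 y2 y3 y4 Hn.
destruct (concyclic4_eqs o _ _ _ _ H) as (k & m & s & m' & s' & E & I).
assert (K : forall p, p = p1 \/ p = p2 \/ p = p3 \/ p = p4 -> p <> o ->
   let y := inv0 (vsub p o) in
   s * dot y y + dot m y + k = 0 /\ s' * dot y y + dot m' y = 0).
{ intros p Hp Hne y; destruct (E p Hp) as [E1 E2].
  assert (N := vsub_neq0 _ _ Hne).
  pose proof (dot_self_pos _ N) as P.
  unfold y; rewrite inv0_norm, !dot_inv0_l by exact N; set (q := vsub p o) in *; split.
  - replace (dot m q) with (- k * dot q q - s) by lra; field; lra.
  - replace (dot m' q) with (- s') by lra; field; lra. }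
pose proof (K p1 ltac:(auto) H1) as K1; pose proof (K p2 ltac:(auto) H2) as K2.
pose proof (K p3 ltac:(auto) H3) as K3; pose proof (K p4 ltac:(auto) H4) as K4.
cbv zeta in K1, K2, K3, K4; fold y1 in K1; fold y2 in K2; fold y3 in K3; fold y4 in K4.
assert (Lv : forall n a b, dot n (vsub a b) = dot n a - dot n b) by dring.
destruct (Req_dec s 0) as [Es | Es].
- destruct (Req_dec s' 0) as [Es' | Es'].
  + subst s s'; elim Hn; apply (cross_eq0_of_perp m m'); auto; rewrite Lv; lra.
  + exists (vscale (/ s') m'), 0; intros y Hy.
    assert (Q : s' * dot y y + dot m' y = 0) by (destruct Hy as [-> | [-> | [-> | ->]]]; tauto).
    transitivity (/ s' * (s' * dot y y + dot m' y)); [ | rewrite Q; ring].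
    replace (dot (vscale (/ s') m') y) with (/ s' * dot m' y) by dring.
    field; auto.
- exists (vscale (/ s) m), (k / s); intros y Hy.
  assert (Q : s * dot y y + dot m y + k = 0) by (destruct Hy as [-> | [-> | [-> | ->]]]; tauto).
  transitivity (/ s * (s * dot y y + dot m y + k)); [ | rewrite Q; ring].
  replace (dot (vscale (/ s) m) y) with (/ s * dot m y) by dring.
  field; auto.
Qed.

(** * Inversion at a point of the patch *)

Definition vcont (f : R -> R -> R3) (u v : R) : Prop :=
  continuity_2d_pt (fun s t => c1 (f s t)) u v /\
  continuity_2d_pt (fun s t => c2 (f s t)) u v /\
  continuity_2d_pt (fun s t => c3 (f s t)) u v.

Lemma vcont_const (a : R3) (u v : R) : vcont (fun _ _ => a) u v.
Proof. repeat split; apply continuity_2d_pt_const. Qed.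

Lemma vcont_vscale (k : R -> R -> R) (f : R -> R -> R3) (u v : R) :
  continuity_2d_pt k u v -> vcont f u v -> vcont (fun s t => vscale (k s t) (f s t)) u v.
Proof. intros Hk (F1 & F2 & F3); repeat split; now apply continuity_2d_pt_mult. Qed.

Lemma vcont_vadd (f g : R -> R -> R3) (u v : R) :
  vcont f u v -> vcont g u v -> vcont (fun s t => vadd (f s t) (g s t)) u v.
Proof. intros (F1 & F2 & F3) (G1 & G2 & G3); repeat split; now apply continuity_2d_pt_plus. Qed.

Lemma vcont_vsub (f g : R -> R -> R3) (u v : R) :
  vcont f u v -> vcont g u v -> vcont (fun s t => vsub (f s t) (g s t)) u v.
Proof.
intros Hf Hg; apply vcont_vadd; [exact Hf | apply vcont_vscale; [apply continuity_2d_pt_const | exact Hg]].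
Qed.

Lemma continuity_dot (f g : R -> R -> R3) (u v : R) :
  vcont f u v -> vcont g u v -> continuity_2d_pt (fun s t => dot (f s t) (g s t)) u v.
Proof.
intros (F1 & F2 & F3) (G1 & G2 & G3); unfold dot.
repeat apply continuity_2d_pt_plus; now apply continuity_2d_pt_mult.
Qed.

Lemma vcont_cross (f g : R -> R -> R3) (u v : R) :
  vcont f u v -> vcont g u v -> vcont (fun s t => cross (f s t) (g s t)) u v.
Proof.
intros (F1 & F2 & F3) (G1 & G2 & G3).
repeat split; apply continuity_2d_pt_minus; now apply continuity_2d_pt_mult.
Qed.

Lemma vcont_inv0 (f : R -> R -> R3) (u v : R) :
  vcont f u v -> f u v <> vzero -> vcont (fun s t => inv0 (f s t)) u v.
Proof.
intros Hf Hn; apply vcont_vscale; [apply continuity_2d_pt_inv | exact Hf].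
- now apply continuity_dot.
- now apply Rgt_not_eq, dot_self_pos.
Qed.

Lemma continuity_2d_swap (f : R -> R -> R) (u v : R) :
  continuity_2d_pt f u v -> continuity_2d_pt (fun s t => f t s) v u.
Proof. intros H eps; destruct (H eps) as [d Hd]; exists d; intros; now apply Hd. Qed.

Lemma continuity_2d_fix1 (f : R -> R -> R) (u0 u v : R) :
  continuity_2d_pt f u0 v -> continuity_2d_pt (fun _ t => f u0 t) u v.
Proof.
intros H eps; destruct (H eps) as [d Hd]; exists d; intros; apply Hd; auto.
rewrite Rminus_diag, Rabs_R0; apply cond_pos.
Qed.

Lemma continuity_2d_fix2 (f : R -> R -> R) (v0 u v : R) :
  continuity_2d_pt f u v0 -> continuity_2d_pt (fun s _ => f s v0) u v.
Proof.
intros H eps; destruct (H eps) as [d Hd]; exists d; intros; apply Hd; auto.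
rewrite Rminus_diag, Rabs_R0; apply cond_pos.
Qed.

Lemma vcont_fix1 (f : R -> R -> R3) (u0 u v : R) :
  vcont f u0 v -> vcont (fun _ t => f u0 t) u v.
Proof.
intros (F1 & F2 & F3); repeat split.
- now apply (continuity_2d_fix1 (fun s t => c1 (f s t))).
- now apply (continuity_2d_fix1 (fun s t => c2 (f s t))).
- now apply (continuity_2d_fix1 (fun s t => c3 (f s t))).
Qed.

Lemma vcont_fix2 (f : R -> R -> R3) (v0 u v : R) :
  vcont f u v0 -> vcont (fun s _ => f s v0) u v.
Proof.
intros (F1 & F2 & F3); repeat split.
- now apply (continuity_2d_fix2 (fun s t => c1 (f s t))).
- now apply (continuity_2d_fix2 (fun s t => c2 (f s t))).
- now apply (continuity_2d_fix2 (fun s t => c3 (f s t))).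
Qed.

Lemma continuity_2d_pt_section (f : R -> R -> R) (u v : R) :
  continuity_2d_pt f u v -> continuity_pt (f u) v.
Proof.
intros H eps Heps; destruct (H (mkposreal eps Heps)) as [d Hd].
exists d; split; [apply cond_pos|].
intros t [_ Ht]; apply (Hd u t); [|exact Ht].
rewrite Rminus_diag, Rabs_R0; apply cond_pos.
Qed.

Lemma continuity_2d_neq0 (f : R -> R -> R) (u v : R) :
  continuity_2d_pt f u v -> f u v <> 0 ->
  exists d, 0 < d /\ forall s t, Rabs (s - u) < d -> Rabs (t - v) < d -> f s t <> 0.
Proof.
intros H Hn; destruct (H (mkposreal _ (Rabs_pos_lt _ Hn))) as [d Hd].
exists d; split; [apply cond_pos|].
intros s t Hs Ht E; specialize (Hd s t Hs Ht); simpl in Hd.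
rewrite E, Rminus_0_l, Rabs_Ropp in Hd; lra.
Qed.

Lemma continuity_2d_eq0_closure (f : R -> R -> R) (u v : R) : in_square u v ->
  continuity_2d_pt f u v ->
  (forall s t, 0 < s < 1 -> 0 < t < 1 -> f s t = 0) -> f u v = 0.
Proof.
intros [Hu Hv] Hc H; destruct (Req_dec (f u v) 0) as [|Hn]; auto.
destruct (continuity_2d_neq0 _ _ _ Hc Hn) as (d & Hd & K).
assert (L : forall a, 0 <= a <= 1 -> exists b, 0 < b < 1 /\ Rabs (b - a) < d).
{ intros a Ha; set (m := Rmin (d / 2) (1 / 4)).
  pose proof (Rmin_l (d / 2) (1 / 4)); pose proof (Rmin_r (d / 2) (1 / 4)).
  assert (0 < m) by (apply Rmin_glb_lt; lra); fold m in H0, H1.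
  (* A small step towards 1/2 reaches the interior from every point of [0,1], the endpoints
     included. *)
  exists (a + m * (1 - 2 * a)); split; [nra | apply Rabs_def1; nra]. }
destruct (L u Hu) as (s & Hs & Ds); destruct (L v Hv) as (t & Ht & Dt).
elim (K s t Ds Dt); auto.
Qed.

(** The last clause says that no open piece of the patch lies on a circle or line. *)
Definition circular_patch (x : R -> R -> R3) : Prop :=
  (forall u v, vcont x u v) /\
  (forall u v u' v', in_square u v -> in_square u' v' -> x u v = x u' v' -> u = u' /\ v = v') /\
  (forall u0 u1 v0 v1, 0 <= u0 -> u0 < u1 -> u1 <= 1 -> 0 <= v0 -> v0 < v1 -> v1 <= 1 ->
     concyclic4 (x u0 v0) (x u1 v0) (x u1 v1) (x u0 v1)) /\
  (forall o p d u0 u1 v0 v1, 0 <= u0 -> u0 < u1 -> u1 <= 1 -> 0 <= v0 -> v0 < v1 -> v1 <= 1 ->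
     d <> vzero ->
     ~ (forall u v, u0 < u < u1 -> v0 < v < v1 ->
          x u v <> o /\ cross (vsub (inv0 (vsub (x u v) o)) p) d = vzero)).

Lemma concyclic4_rev (p1 p2 p3 p4 : R3) : concyclic4 p1 p2 p3 p4 -> concyclic4 p1 p4 p3 p2.
Proof.
intros [(c & e1 & e2 & r & H) | (a & d & H)]; [left; exists c, e1, e2, r | right; exists a, d]; tauto.
Qed.

Lemma vcont_swap (f : R -> R -> R3) (u v : R) : vcont f u v -> vcont (fun s t => f t s) v u.
Proof.
intros (F1 & F2 & F3); repeat split.
- exact (continuity_2d_swap _ _ _ F1).
- exact (continuity_2d_swap _ _ _ F2).
- exact (continuity_2d_swap _ _ _ F3).
Qed.

Lemma circular_patch_swap (x : R -> R -> R3) :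
  circular_patch x -> circular_patch (fun u v => x v u).
Proof.
intros (C & I & Q & N); split; [|split; [|split]].
- intros u v; apply (vcont_swap x), C.
- intros u v u' v' [] [] E; destruct (I v u v' u'); auto; split; auto.
- intros; apply concyclic4_rev; auto.
- intros o p d u0 u1 v0 v1 ? ? ? ? ? ? Hd K.
  apply (N o p d v0 v1 u0 u1); auto.
Qed.

(** The patch seen from its point [x u0 v0], which is sent to infinity. *)
Definition invpt (x : R -> R -> R3) (u0 v0 u v : R) : R3 :=
  inv0 (vsub (x u v) (x u0 v0)).

(** Power of the point [invpt u0 v] with respect to the circle through
    [invpt u v0] and [invpt u v]. *)
Definition ipow (x : R -> R -> R3) (u0 v0 u v : R) : R :=
  dot (vsub (invpt x u0 v0 u v) (invpt x u0 v0 u0 v))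
      (vsub (invpt x u0 v0 u v0) (invpt x u0 v0 u0 v)).

Section Inverted.

Variable x : R -> R -> R3.
Hypothesis P : circular_patch x.
Variables u0 v0 : R.
Hypothesis (Hu0 : 0 <= u0) (Hv0 : 0 <= v0).

Notation y := (invpt x u0 v0).

Lemma patch_neq (u v u' v' : R) : in_square u v -> in_square u' v' ->
  u <> u' \/ v <> v' -> x u v <> x u' v'.
Proof. intros S S' H E; destruct P as (_ & I & _ & _), (I _ _ _ _ S S' E); tauto. Qed.

Lemma invpt_neq (u v u' v' : R) : in_square u v -> in_square u' v' -> in_square u0 v0 ->
  u <> u0 \/ v <> v0 -> u' <> u0 \/ v' <> v0 -> u <> u' \/ v <> v' -> y u v <> y u' v'.
Proof.
intros S S' S0 H H' D E; apply (patch_neq u v u' v' S S' D).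
apply inv0_inj in E; try (apply vsub_neq0, patch_neq; auto).
apply R3_ext; [apply (f_equal c1) in E | apply (f_equal c2) in E | apply (f_equal c3) in E];
  vunfold; lra.
Qed.

Lemma invpt_cont (u v : R) : in_square u v -> in_square u0 v0 -> u <> u0 \/ v <> v0 -> vcont y u v.
Proof.
intros S S0 D; apply vcont_inv0.
- apply vcont_vsub; [apply P | apply vcont_const].
- now apply vsub_neq0, patch_neq.
Qed.

Ltac sq := unfold in_square; lra.

Lemma ipow_cont (u v : R) : u0 < u <= 1 -> v0 < v <= 1 ->
  continuity_2d_pt (ipow x u0 v0) u v.
Proof.
intros Hu Hv; unfold ipow; apply continuity_dot; apply vcont_vsub.
- apply invpt_cont; [sq | sq | left; lra].
- apply (vcont_fix1 (invpt x u0 v0)), invpt_cont; [sq | sq | right; lra].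
- apply (vcont_fix2 (invpt x u0 v0)), invpt_cont; [sq | sq | left; lra].
- apply (vcont_fix1 (invpt x u0 v0)), invpt_cont; [sq | sq | right; lra].
Qed.

(** The inequalities come from injectivity of the patch. [t <> 0] lets the sphere equation be
    divided by [t] when powers are compared, and [t <> 1] makes the power nonzero. *)
Lemma invpt_on_line (u v : R) : u0 < u <= 1 -> v0 < v <= 1 ->
  exists t, y u v = vadd (y u v0) (vscale t (vsub (y u0 v) (y u v0))) /\
    t <> 0 /\ t <> 1 /\ ipow x u0 v0 u v = (1 - t) * dot (vsub (y u0 v) (y u v0)) (vsub (y u0 v) (y u v0)).
Proof.
intros Hu Hv.
set (t := dot (vsub (y u v) (y u v0)) (vsub (y u0 v) (y u v0)) /
  dot (vsub (y u0 v) (y u v0)) (vsub (y u0 v) (y u v0))).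
assert (ab : y u0 v <> y u v0) by (apply invpt_neq; first [sq | left; lra | right; lra]).
assert (ya : y u v <> y u v0) by (apply invpt_neq; first [sq | left; lra | right; lra]).
assert (yb : y u v <> y u0 v) by (apply invpt_neq; first [sq | left; lra | right; lra]).
assert (E : vsub (y u v) (y u v0) = vscale t (vsub (y u0 v) (y u v0))).
{ apply cross_eq0_parallel; [ | now apply vsub_neq0].
  destruct P as (_ & _ & Q & _).
  apply concyclic4_inv_collinear; [ apply Q; lra | | | ];
    apply patch_neq; first [sq | left; lra | right; lra]. }
assert (E' : y u v = vadd (y u v0) (vscale t (vsub (y u0 v) (y u v0)))).
{ rewrite <- E; vring. }
exists t; repeat split.
- exact E'.
- intros T; apply ya; rewrite E', T; vring.
- intros T; apply yb; rewrite E', T; vring.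
- unfold ipow; rewrite E'; dring.
Qed.

Lemma invpt_unbounded (u M : R) : u0 < u <= 1 -> v0 < 1 ->
  exists d, 0 < d /\ forall v, v0 < v <= 1 -> v < v0 + d -> M < dot (y u0 v) (y u0 v).
Proof.
intros Hu Hv.
assert (C : continuity_2d_pt (fun s t => dot (vsub (x s t) (x u0 v0)) (vsub (x s t) (x u0 v0))) u0 v0).
{ apply continuity_dot; (apply vcont_vsub; [apply P | apply vcont_const]). }
assert (Pos : 0 < / (Rabs M + 1)) by (apply Rinv_0_lt_compat; pose proof (Rabs_pos M); lra).
destruct (C (mkposreal _ Pos)) as [d Hd]; simpl in Hd.
exists d; split; [apply cond_pos|]; intros v Hv1 Hv2.
assert (N : vsub (x u0 v) (x u0 v0) <> vzero)
  by (apply vsub_neq0, patch_neq; first [sq | right; lra]).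
unfold invpt; rewrite inv0_norm by exact N; apply dot_self_pos in N.
assert (K := Hd u0 v).
rewrite Rminus_diag, Rabs_R0 in K.
specialize (K (cond_pos d) ltac:(apply Rabs_def1; lra)).
assert (Z : dot (vsub (x u0 v0) (x u0 v0)) (vsub (x u0 v0) (x u0 v0)) = 0) by dring.
rewrite Z, Rminus_0_r, Rabs_pos_eq in K by lra.
apply Rle_lt_trans with (Rabs M); [apply Rle_abs|].
apply Rlt_trans with (Rabs M + 1); [lra|].
rewrite <- (Rinv_inv (Rabs M + 1)); apply Rinv_lt_contravar; auto.
now apply Rmult_lt_0_compat.
Qed.

(** If the power were negative, [invpt u v] would be farther from
    [invpt u v0] than [invpt u0 v] is, and this would persist for [v -> v0], where
    the former tends to [invpt u v0] and the latter to infinity. *)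
Lemma ipow_pos (u v : R) : u0 < u <= 1 -> v0 < v <= 1 -> 0 < ipow x u0 v0 u v.
Proof.
intros Hu Hv; apply Rnot_le_lt; intros Hle.
assert (Nz : forall t, v0 < t <= 1 -> ipow x u0 v0 u t <> 0).
{ intros t Ht; destruct (invpt_on_line u t Hu Ht) as (s & _ & _ & S1 & ->).
  apply Rmult_integral_contrapositive; split; [lra|].
  apply Rgt_not_eq, dot_self_pos, vsub_neq0, invpt_neq; first [sq | left; lra | right; lra]. }
assert (Neg : forall t, v0 < t <= v -> ipow x u0 v0 u t < 0).
{ intros t Ht; destruct (Rtotal_order (ipow x u0 v0 u t) 0) as [|[E|G]]; auto.
  - elim (Nz t); lra.
  - exfalso; assert (tv : t < v).
    { destruct (Req_dec t v) as [->|]; [lra|]; lra. }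
    assert (vn : ipow x u0 v0 u v < 0) by (pose proof (Nz v Hv); lra).
    destruct (IVT_interv (fun s => - ipow x u0 v0 u s) t v) as [z [Hz Ez]]; try lra.
    + intros a Ha; apply continuity_pt_opp, continuity_2d_pt_section, ipow_cont; lra.
    + apply (Nz z); lra. }
assert (Far : forall t, v0 < t <= v ->
   dot (vsub (y u0 t) (y u v0)) (vsub (y u0 t) (y u v0)) <=
   dot (vsub (y u t) (y u v0)) (vsub (y u t) (y u v0))).
{ intros t Ht; destruct (invpt_on_line u t Hu ltac:(lra)) as (s & E & _ & _ & S).
  specialize (Neg t Ht); rewrite S in Neg; rewrite E.
  set (D := vsub (y u0 t) (y u v0)) in *.
  assert (G := dot_self_ge0 D).
  assert (Q : forall p k, dot (vsub (vadd p (vscale k D)) p) (vsub (vadd p (vscale k D)) p)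
    = k ^ 2 * dot D D) by dring.
  rewrite Q.
  assert (1 < s) by nra; nra. }
set (a := y u v0) in *.
(* If |b|^2 > 2|a|^2 + 2, then |b - a|^2 > 1 by the inequality [I] below, whereas the image of (u,t)
   is at distance less than 1 from [a] for t near v0. This contradicts [Far]. *)
destruct (invpt_unbounded u (2 * dot a a + 2) Hu ltac:(lra)) as (d & Hd & B).
assert (C : continuity_2d_pt (fun s t => dot (vsub (y s t) a) (vsub (y s t) a)) u v0).
{ apply continuity_dot; (apply vcont_vsub; [apply invpt_cont; first [sq | left; lra] | apply vcont_const]). }
destruct (C (mkposreal 1 Rlt_0_1)) as [d' Hd']; simpl in Hd'.
set (t := v0 + Rmin (v - v0) (Rmin d d') / 2).
assert (M1 : 0 < Rmin (v - v0) (Rmin d d')).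
{ repeat apply Rmin_glb_lt; try lra; apply cond_pos. }
pose proof (Rmin_l (v - v0) (Rmin d d')); pose proof (Rmin_r (v - v0) (Rmin d d')).
pose proof (Rmin_l d d'); pose proof (Rmin_r d d').
assert (T : v0 < t <= v) by (unfold t; lra).
specialize (Far t T); specialize (B t ltac:(lra) ltac:(unfold t; lra)).
specialize (Hd' u t ltac:(rewrite Rminus_diag, Rabs_R0; apply cond_pos)
  ltac:(unfold t; apply Rabs_def1; lra)).
fold a in Hd'.
assert (Z : dot (vsub a a) (vsub a a) = 0) by dring.
rewrite Z, Rminus_0_r in Hd'; apply Rabs_def2 in Hd'.
set (b := y u0 t) in *.
assert (I : dot b b <= 2 * dot (vsub b a) (vsub b a) + 2 * dot a a).
{ assert (G := dot_self_ge0 (vsub b (vscale 2 a))); vunfold; lra. }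
lra.
Qed.

(** Both sides are the power of one point with respect to one sphere, measured along two lines. The
    sphere passes through the images of the rectangle [u1,u2] x [v0,v]; non-collinearity provides
    it. *)
Lemma ipow_const_of_noncollinear (u1 u2 v : R) : u0 < u1 <= 1 -> u0 < u2 <= 1 -> v0 < v <= 1 ->
  u1 < u2 -> cross (vsub (y u2 v0) (y u1 v0)) (vsub (y u0 v) (y u1 v0)) <> vzero ->
  ipow x u0 v0 u1 v = ipow x u0 v0 u2 v.
Proof.
intros H1 H2 Hv L Hn.
destruct (invpt_on_line u1 v H1 Hv) as (t1 & E1 & T1 & _ & ->).
destruct (invpt_on_line u2 v H2 Hv) as (t2 & E2 & T2 & _ & ->).
destruct (concyclic4_inv_sphere (x u0 v0) (x u1 v0) (x u2 v0) (x u2 v) (x u1 v)) as (m & s & K).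
- apply P; lra.
- apply patch_neq; first [sq | left; lra].
- apply patch_neq; first [sq | left; lra].
- apply patch_neq; first [sq | left; lra].
- apply patch_neq; first [sq | left; lra].
- change (cross (vsub (y u2 v0) (y u1 v0)) (vsub (y u1 v) (y u1 v0)) <> vzero).
  intros E; apply Hn.
  assert (F : cross (vsub (y u2 v0) (y u1 v0)) (vsub (y u1 v) (y u1 v0)) =
    vscale t1 (cross (vsub (y u2 v0) (y u1 v0)) (vsub (y u0 v) (y u1 v0))))
    by (rewrite E1; vring).
  rewrite E in F; apply R3_ext;
    [apply (f_equal c1) in F | apply (f_equal c2) in F | apply (f_equal c3) in F];
    simpl in F |- *; symmetry in F; apply Rmult_integral in F; tauto.
- pose proof (K (y u1 v0) ltac:(auto)) as K1; pose proof (K (y u2 v0) ltac:(auto)) as K2.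
  pose proof (K (y u2 v) ltac:(auto)) as K3; pose proof (K (y u1 v) ltac:(auto)) as K4.
  rewrite E1 in K4; rewrite E2 in K3.
  set (b := y u0 v) in *; set (a1 := y u1 v0) in *; set (a2 := y u2 v0) in *.
  (* power of the point [b]: the sphere meets the line [b a] at parameters 0 and t *)
  assert (W : forall a t, t <> 0 -> dot a a + dot m a + s = 0 ->
     dot (vadd a (vscale t (vsub b a))) (vadd a (vscale t (vsub b a)))
       + dot m (vadd a (vscale t (vsub b a))) + s = 0 ->
     (1 - t) * dot (vsub b a) (vsub b a) = dot b b + dot m b + s).
  { intros a t Ht A B; apply (Rmult_eq_reg_l t); auto.
    transitivity (t * (dot b b + dot m b + s) - (dot (vadd a (vscale t (vsub b a))) (vadd a (vscale t (vsub b a)))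
       + dot m (vadd a (vscale t (vsub b a))) + s) + (1 - t) * (dot a a + dot m a + s));
      [dring | rewrite A, B; ring]. }
  rewrite (W a1 t1), (W a2 t2); auto.
Qed.

(** If the powers differed at (u1,v), they would differ from those at u2 on a whole neighbourhood.
    All positions there would then be collinear, and an open piece of the inverted patch would lie
    on one line, which [circular_patch] excludes. *)
Lemma ipow_const (u1 u2 v : R) : u0 < u1 <= 1 -> u0 < u2 <= 1 -> v0 < v <= 1 ->
  ipow x u0 v0 u1 v = ipow x u0 v0 u2 v.
Proof.
assert (G : forall u1 u2 v, u0 < u1 <= 1 -> u0 < u2 <= 1 -> v0 < v <= 1 -> u1 < u2 ->
  ipow x u0 v0 u1 v = ipow x u0 v0 u2 v).
{ clear u1 u2 v; intros u1 u2 v H1 H2 Hv L.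
  apply NNPP; intros Hne.
  assert (C : continuity_2d_pt (fun s t => ipow x u0 v0 s t - ipow x u0 v0 u2 t) u1 v).
  { apply continuity_2d_pt_minus; [apply ipow_cont; lra|].
    apply (continuity_2d_fix1 (ipow x u0 v0)), ipow_cont; lra. }
  destruct (continuity_2d_neq0 _ _ _ C) as (d & Hd & K); [lra|].
  set (r := Rmin d (Rmin (u1 - u0) (v - v0)) / 2).
  assert (R0 : 0 < r < d /\ r < u1 - u0 /\ r < v - v0).
  { assert (0 < Rmin d (Rmin (u1 - u0) (v - v0))) by (repeat apply Rmin_glb_lt; lra).
    pose proof (Rmin_l d (Rmin (u1 - u0) (v - v0))); pose proof (Rmin_r d (Rmin (u1 - u0) (v - v0))).
    pose proof (Rmin_l (u1 - u0) (v - v0)); pose proof (Rmin_r (u1 - u0) (v - v0)).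
    unfold r; lra. }
  destruct R0 as (R0 & R1 & R2); clearbody r.
  assert (Col : forall s t, u1 - r < s <= u1 -> v - r < t <= v ->
    cross (vsub (y u2 v0) (y s v0)) (vsub (y u0 t) (y s v0)) = vzero).
  { intros s t Hs Ht; apply NNPP; intros Hn.
    apply (K s t); try (apply Rabs_def1; lra).
    rewrite (ipow_const_of_noncollinear s u2 t); first [exact Hn | lra]. }
  (* all of [y s v0], [y u0 t] then lie on the line through [y u1 v0] and [y u2 v0] *)
  set (a := y u1 v0); set (w := vsub (y u2 v0) a).
  assert (Nw : w <> vzero) by (apply vsub_neq0, invpt_neq; first [sq | left; lra]).
  assert (Lb : forall t, v - r < t <= v -> cross (vsub (y u0 t) a) w = vzero).
  { intros t Ht; specialize (Col u1 t ltac:(lra) Ht); fold a in Col; fold w in Col.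
    replace (cross (vsub (y u0 t) a) w) with (vscale (-1) (cross w (vsub (y u0 t) a))) by vring.
    rewrite Col; vring. }
  assert (La : forall s, u1 - r < s <= u1 -> cross (vsub (y s v0) a) w = vzero).
  { intros s Hs; specialize (Col s v Hs ltac:(lra)).
    assert (Lv := Lb v ltac:(lra)).
    assert (nb : vsub (y u2 v0) (y u0 v) <> vzero)
      by (apply vsub_neq0, invpt_neq; first [sq | left; lra | right; lra]).
    set (b := y u0 v) in *; set (c := y s v0) in *; set (a2 := y u2 v0) in *.
    assert (Eb := cross_eq0_parallel _ _ Lv Nw).
    assert (Ec : cross (vsub c b) (vsub a2 b) = vzero).
    { rewrite <- Col; vring. }
    apply cross_eq0_parallel in Ec; auto.
    set (k := _ / _) in Eb; set (l := _ / _) in Ec.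
    assert (E : vsub c a = vadd (vscale k w) (vscale l (vsub w (vscale k w)))).
    { replace (vsub c a) with (vadd (vsub b a) (vsub c b)) by vring.
      rewrite Ec; replace (vsub a2 b) with (vsub w (vsub b a)) by (unfold w; vring).
      rewrite Eb; reflexivity. }
    rewrite E; vring. }
  destruct P as (_ & _ & _ & N).
  apply (N (x u0 v0) a w (u1 - r) u1 (v - r) v); try lra; auto.
  intros s t Hs Ht; split.
  - apply patch_neq; first [sq | left; lra].
  - change (cross (vsub (y s t) a) w = vzero).
    destruct (invpt_on_line s t ltac:(lra) ltac:(lra)) as (k & -> & _).
    replace (cross _ w) with (vadd (cross (vsub (y s v0) a) w)
      (vscale k (vsub (cross (vsub (y u0 t) a) w) (cross (vsub (y s v0) a) w)))) by vring.
    rewrite La, Lb by lra; vring. }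
intros H1 H2 Hv; destruct (Rtotal_order u1 u2) as [L | [-> | L]]; auto.
symmetry; auto.
Qed.

End Inverted.

(** * Spheres relating two parameter lines *)

(** [g] is the inversion with center [b] and power [rho] conjugated by [inv0]; it is a
    reflection when the sphere of that inversion passes through the origin. *)
Lemma inversion_conj (o b : R3) (rho : R) : b <> vzero -> 0 < rho ->
  exists g, valid_gs g /\
    (gs_defined g o /\ gs_apply g o = vadd o (inv0 b)) /\
    forall a, a <> vzero -> a <> b ->
      let y := vadd b (vscale (rho / dot (vsub a b) (vsub a b)) (vsub a b)) in
      y <> vzero ->
      gs_defined g (vadd o (inv0 a)) /\ gs_apply g (vadd o (inv0 a)) = vadd o (inv0 y).
Proof.
intros Hb Hr.
pose proof (dot_self_pos b Hb) as S2.
(* [k] is the power of the origin with respect to the sphere with center [b] and squared radius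
   [rho]. Its image under [inv0] is the sphere with center b/k and radius sqrt(rho)/|k|, or for k =
   0 the plane b.y = 1/2. *)
set (k := dot b b - rho).
assert (Gen : forall a, a <> vzero -> a <> b ->
   let y := vadd b (vscale (rho / dot (vsub a b) (vsub a b)) (vsub a b)) in
   y <> vzero ->
   let N := dot a a - 2 * dot a b + dot b b in
   let M := dot a a * dot b b - 2 * k * dot a b + k ^ 2 in
   0 < N /\ 0 < M /\ inv0 y = vscale (/ M) (vadd (vscale (N - rho) b) (vscale rho a))).
{ intros a Ha Hab y Hy N M.
  assert (EN : dot (vsub a b) (vsub a b) = N) by (unfold N; dring).
  pose proof (dot_self_pos _ (vsub_neq0 _ _ Hab)) as PN; rewrite EN in PN.
  unfold y in *; rewrite EN in *; clear y.
  assert (EM : dot (vadd b (vscale (rho / N) (vsub a b))) (vadd b (vscale (rho / N) (vsub a b))) = M / N).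
  { transitivity (dot b b + 2 * (rho / N) * (dot a b - dot b b) + (rho / N) ^ 2 * dot (vsub a b) (vsub a b));
      [dring|].
    rewrite EN.
    transitivity ((dot b b * N + 2 * rho * (dot a b - dot b b) + rho ^ 2) / N); [field; lra|].
    f_equal; unfold M, k, N; ring. }
  apply dot_self_pos in Hy.
  assert (PM : 0 < M).
  { rewrite EM in Hy; apply (Rmult_lt_compat_r N) in Hy; auto.
    replace (M / N * N) with M in Hy by (field; lra); lra. }
  repeat split; auto; unfold inv0; rewrite EM.
  apply R3_ext; vunfold; field; lra. }
destruct (Req_dec k 0) as [Ek | Nk].
- set (l := sqrt (dot b b)).
  assert (Pl : 0 < l) by now apply sqrt_lt_R0.
  assert (Ll : l * l = dot b b) by (apply sqrt_sqrt; lra).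
  exists (PlaneRefl (vscale (/ l) b) (dot (vscale (/ l) b) o + / (2 * l)));
    unfold gs_apply, gs_defined, valid_gs.
  assert (Sc : forall p, vsub (vadd o p) (vscale (2 * (dot (vscale (/ l) b) (vadd o p)
       - (dot (vscale (/ l) b) o + / (2 * l)))) (vscale (/ l) b)) =
     vadd (vadd o p) (vscale ((1 - 2 * dot b p) / dot b b) b)).
  { intros p.
    replace (dot (vscale (/ l) b) (vadd o p)) with (dot (vscale (/ l) b) o + / l * dot b p) by dring.
    rewrite <- Ll; set (q := dot b p); set (r := dot (vscale (/ l) b) o).
    apply R3_ext; vunfold; field; lra. }
  split; [|split; [split|]]; auto.
  + transitivity (/ l * / l * dot b b); [dring | rewrite <- Ll; field; lra].
  + pose proof (Sc vzero) as S0; replace (vadd o vzero) with o in S0 by vring; rewrite S0.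
    replace (dot b vzero) with 0 by (unfold vzero; dring).
    unfold inv0; apply R3_ext; vunfold; field; lra.
  + intros a Ha Hab Hy; split; auto.
    rewrite Sc.
    destruct (Gen a Ha Hab Hy) as (PN & PM & E); rewrite E.
    rewrite dot_inv0_l; unfold inv0; apply dot_self_pos in Ha.
    rewrite Ek.
    replace rho with (dot b b) by (unfold k in Ek; lra).
    replace (dot b a) with (dot a b) by dring.
    set (A := dot a a) in *; set (B := dot b b) in *; set (C := dot a b) in *.
    apply R3_ext; simpl; field; lra.
- set (c := vadd o (vscale (/ k) b)).
  set (r := sqrt rho / Rabs k).
  assert (Er : r ^ 2 = rho / k ^ 2).
  { unfold r; assert (Hk := Rabs_no_R0 k Nk).
    replace ((sqrt rho / Rabs k) ^ 2) with ((sqrt rho * sqrt rho) / (Rabs k ^ 2)) by (field; auto).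
    rewrite sqrt_sqrt by lra; rewrite pow2_abs; reflexivity. }
  exists (SphInv c r); unfold gs_apply, gs_defined, valid_gs; rewrite Er.
  split; [|split; [split|]].
  + apply Rdiv_lt_0_compat; [now apply sqrt_lt_R0 | now apply Rabs_pos_lt].
  + intros E; apply Hb; unfold c in E.
    assert (Z : vscale (/ k) b = vzero).
    { replace (vscale (/ k) b) with (vsub (vadd o (vscale (/ k) b)) o) by vring.
      rewrite <- E; vring. }
    apply (f_equal (vscale k)) in Z.
    apply R3_ext; [apply (f_equal c1) in Z | apply (f_equal c2) in Z | apply (f_equal c3) in Z];
     simpl in Z; rewrite <- Rmult_assoc, Rinv_r in Z by auto; simpl; lra.
  + replace (vsub o c) with (vscale (- / k) b) by (unfold c; vring).
    replace (dot (vscale (- / k) b) (vscale (- / k) b)) with (/ k * / k * dot b b) by dring.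
    unfold c, inv0; set (B := dot b b) in *.
    assert (R0 : rho = B - k) by (unfold k; ring); rewrite R0; clearbody B k.
    apply R3_ext; simpl; field; split; auto; lra.
  + intros a Ha Hab Hy.
    destruct (Gen a Ha Hab Hy) as (PN & PM & E); rewrite E.
    apply dot_self_pos in Ha.
    replace (vsub (vadd o (inv0 a)) c) with (vsub (inv0 a) (vscale (/ k) b)) by (unfold c; vring).
    assert (En : dot (vsub (inv0 a) (vscale (/ k) b)) (vsub (inv0 a) (vscale (/ k) b)) =
       (dot a a * dot b b - 2 * k * dot a b + k ^ 2) / (dot a a * k ^ 2)).
    { unfold inv0; set (A := dot a a) in *.
      transitivity (/ A * / A * dot a a - 2 * / A * / k * dot a b + / k * / k * dot b b); [dring|].
      fold A; field; split; auto; lra. }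
    split.
    * intros F; assert (Z : vsub (inv0 a) (vscale (/ k) b) = vzero).
      { replace (vsub (inv0 a) (vscale (/ k) b)) with (vsub (vadd o (inv0 a)) c) by (unfold c; vring).
        rewrite F; vring. }
      rewrite Z in En; replace (dot vzero vzero) with 0 in En by (unfold vzero; dring).
      assert (0 < (dot a a * dot b b - 2 * k * dot a b + k ^ 2) / (dot a a * k ^ 2)); [|lra].
      apply Rdiv_lt_0_compat; auto; apply Rmult_lt_0_compat; auto.
      now apply pow2_gt_0.
    * rewrite En; unfold c, inv0.
      assert (R0 : rho = dot b b - k) by (unfold k; ring); rewrite R0.
      set (A := dot a a) in *; set (B := dot b b) in *; set (C := dot a b) in *; clearbody k A B C.
      apply R3_ext; simpl; field; repeat split; auto; lra.
Qed.

Lemma patch_invpt (x : R -> R -> R3) (u0 v0 u v : R) : x u v <> x u0 v0 ->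
  x u v = vadd (x u0 v0) (inv0 (invpt x u0 v0 u v)).
Proof.
intros H; unfold invpt; rewrite inv0_inv0 by now apply vsub_neq0.
vring.
Qed.

Lemma parameter_lines_inverse (x : R -> R -> R3) (v0 v1 : R) : circular_patch x ->
  0 <= v0 -> v0 < v1 -> v1 <= 1 ->
  exists g, valid_gs g /\ forall u, 0 <= u <= 1 ->
    gs_defined g (x u v0) /\ gs_apply g (x u v0) = x u v1.
Proof.
intros P H0 H1 H2.
assert (Hn : forall u v u' v', in_square u v -> in_square u' v' -> u <> u' \/ v <> v' -> x u v <> x u' v')
  by (intros; now apply patch_neq).
assert (N : forall u v, in_square u v -> u <> 0 \/ v <> v0 -> invpt x 0 v0 u v <> vzero).
{ intros; apply inv0_neq0, vsub_neq0, Hn; auto; unfold in_square; lra. }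
destruct (inversion_conj (x 0 v0) (invpt x 0 v0 0 v1) (ipow x 0 v0 1 v1)) as (g & V & [D0 E0] & K).
- apply N; unfold in_square; lra.
- apply ipow_pos; auto; lra.
- exists g; split; auto; intros u Hu.
  destruct (Rle_lt_or_eq_dec 0 u) as [L | <-]; try lra.
  + assert (Sq : in_square u v0 /\ in_square u v1 /\ in_square 0 v1 /\ in_square 0 v0)
      by (unfold in_square; lra).
    destruct Sq as (S1 & S2 & S3 & S4).
    assert (ab : invpt x 0 v0 u v0 <> invpt x 0 v0 0 v1).
    { apply invpt_neq; auto; lra. }
    specialize (K (invpt x 0 v0 u v0) ltac:(apply N; auto; lra) ab).
    cbv zeta in K.
    destruct (invpt_on_line x P 0 v0 ltac:(lra) H0 u v1 ltac:(lra) ltac:(lra)) as (t & E & _ & _ & W).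
    rewrite (ipow_const x P 0 v0 ltac:(lra) H0 1 u v1) in K by lra.
    assert (Ey : invpt x 0 v0 u v1 = vadd (invpt x 0 v0 0 v1)
      (vscale (ipow x 0 v0 u v1 / dot (vsub (invpt x 0 v0 u v0) (invpt x 0 v0 0 v1)) (vsub (invpt x 0 v0 u v0) (invpt x 0 v0 0 v1)))
         (vsub (invpt x 0 v0 u v0) (invpt x 0 v0 0 v1)))).
    { rewrite W.
      set (a := invpt x 0 v0 u v0) in *; set (b := invpt x 0 v0 0 v1) in *.
      replace (dot (vsub b a) (vsub b a)) with (dot (vsub a b) (vsub a b)) by dring.
      apply vsub_neq0, dot_self_pos in ab.
      replace ((1 - t) * dot (vsub a b) (vsub a b) / dot (vsub a b) (vsub a b)) with (1 - t)
        by (field; lra).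
      rewrite E; vring. }
    rewrite <- Ey in K.
    rewrite <- !patch_invpt in K by (apply Hn; auto; lra).
    apply K, N; auto; lra.
  (* The corner u = 0 sits at infinity in the inverted picture, and the inversion about [b]
     exchanges infinity with its center. *)
  + split; auto; rewrite E0; symmetry; apply patch_invpt, Hn; unfold in_square; lra.
Qed.

(** * Infinitesimal quadrilaterals *)

(** In a quadrilateral of size [h] the defect [e] is of order [h ^ 2], so all terms of the
    last equation except [2 * dot n n * dot a b] are negligible against [h ^ 6]. *)
Lemma concyclic4_defect (p1 p2 p3 p4 : R3) : concyclic4 p1 p2 p3 p4 ->
  let a := vsub p2 p1 in let b := vsub p4 p1 in
  let e := vsub (vsub (vsub p3 p1) a) b in let n := cross a b in
  dot n e = 0 /\
  dot n n * (2 * dot a b + 2 * dot e (vadd a b) + dot e e) =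
  dot (cross e b) n * dot a a + dot (cross a e) n * dot b b.
Proof.
intros H a b e n.
destruct (concyclic4_eqs p1 _ _ _ _ H) as (k & m & s & m' & s' & K & I).
assert (S0 : s = 0 /\ s' = 0).
{ destruct (K p1 (or_introl eq_refl)) as [E1 E2].
  vunfold; split; ring_simplify in E1; ring_simplify in E2; lra. }
destruct S0 as [-> ->]; specialize (I eq_refl eq_refl).
destruct (K p2) as [A1 A2]; auto; destruct (K p3) as [C1 C2]; auto.
destruct (K p4) as [B1 B2]; auto; clear K.
fold a in A1, A2; fold b in B1, B2.
assert (Ec : vsub p3 p1 = vadd e (vadd a b)) by (unfold e; vring).
rewrite Ec in C1, C2; clear Ec; clearbody a b e.
rewrite Rplus_0_r in A1, A2, B1, B2, C1, C2.
assert (E2 : dot m' e = 0).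
{ replace (dot m' e) with (dot m' (vadd e (vadd a b)) - dot m' a - dot m' b) by dring; lra. }
assert (D : dot n e = 0).
{ assert (Z : vscale (dot n e) m' = vzero).
  { transitivity (vadd (vscale (dot m' a) (cross b e)) (vadd (vscale (dot m' b) (cross e a))
      (vscale (dot m' e) n))); [unfold n; vring | rewrite A2, B2, E2; vring]. }
  destruct (Req_dec (dot n e) 0) as [|Hn]; auto.
  elim I; replace m' with vzero; [vring|].
  apply (f_equal (vscale (/ dot n e))) in Z.
  apply R3_ext; [apply (f_equal c1) in Z | apply (f_equal c2) in Z | apply (f_equal c3) in Z];
    simpl in Z; rewrite <- Rmult_assoc, Rinv_l in Z by auto; simpl; lra. }
split; auto.
destruct (Req_dec k 0) as [-> | Hk].
- assert (N0 : n = vzero).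
  { apply (cross_eq0_of_perp m m'); auto; lra. }
  rewrite N0; vunfold; ring.
- apply (Rmult_eq_reg_l k); auto.
  (* [e] lies in the plane of [a] and [b]; [R] is its expression in that basis, paired with [m] *)
  assert (R : dot n n * dot m e = dot (cross e b) n * dot m a + dot (cross a e) n * dot m b).
  { transitivity (dot (cross e b) n * dot m a + dot (cross a e) n * dot m b + dot n e * dot m n);
      [unfold n; dring | rewrite D; ring]. }
  transitivity (dot n n * ((k * dot (vadd e (vadd a b)) (vadd e (vadd a b)) + dot m (vadd e (vadd a b)))
     - (k * dot a a + dot m a) - (k * dot b b + dot m b)) - dot n n * dot m e); [dring|].
  rewrite A1, B1, C1, R.
  replace (dot m a) with (- (k * dot a a)) by lra.
  replace (dot m b) with (- (k * dot b b)) by lra; ring.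
Qed.

Definition vlim (s : nat -> R3) (l : R3) : Prop :=
  is_lim_seq (fun n => c1 (s n)) (c1 l) /\ is_lim_seq (fun n => c2 (s n)) (c2 l) /\
  is_lim_seq (fun n => c3 (s n)) (c3 l).

Lemma vlim_dot (s t : nat -> R3) (l m : R3) : vlim s l -> vlim t m ->
  is_lim_seq (fun n => dot (s n) (t n)) (dot l m).
Proof.
intros (S1 & S2 & S3) (T1 & T2 & T3); unfold dot.
repeat apply is_lim_seq_plus'; now apply is_lim_seq_mult'.
Qed.

Lemma vlim_cross (s t : nat -> R3) (l m : R3) : vlim s l -> vlim t m ->
  vlim (fun n => cross (s n) (t n)) (cross l m).
Proof.
intros (S1 & S2 & S3) (T1 & T2 & T3); repeat split; simpl;
apply is_lim_seq_minus'; now apply is_lim_seq_mult'.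
Qed.

Lemma vlim_vadd (s t : nat -> R3) (l m : R3) : vlim s l -> vlim t m ->
  vlim (fun n => vadd (s n) (t n)) (vadd l m).
Proof. intros (S1 & S2 & S3) (T1 & T2 & T3); repeat split; simpl; now apply is_lim_seq_plus'. Qed.

Lemma derivable_pt_lim_seq (f : R -> R) (t l : R) (h : nat -> R) :
  derivable_pt_lim f t l -> is_lim_seq h 0 -> (forall n, h n <> 0) ->
  is_lim_seq (fun n => / h n * (f (t + h n) - f t)) l.
Proof.
intros Hf Hh Hn; apply is_lim_seq_Reals; intros eps Heps.
destruct (Hf eps Heps) as [d Hd].
apply is_lim_seq_Reals in Hh; destruct (Hh d (cond_pos d)) as [N HN].
exists N; intros n Hge; specialize (HN n Hge); unfold Rdist in *.
rewrite Rminus_0_r in HN; rewrite Rmult_comm; now apply Hd.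
Qed.

(** The mean value theorem in u, then in v, as in the proof of Schwarz's theorem. *)
Lemma mixed_difference_seq (f fu fuv : R -> R -> R) (u v : R) (h : nat -> R) :
  (forall s t, derivable_pt_lim (fun s => f s t) s (fu s t)) ->
  (forall s t, derivable_pt_lim (fun t => fu s t) t (fuv s t)) ->
  continuity_2d_pt fuv u v -> is_lim_seq h 0 -> (forall n, 0 < h n) ->
  is_lim_seq (fun n => / (h n * h n) *
    (f (u + h n) (v + h n) - f u v - (f (u + h n) v - f u v) - (f u (v + h n) - f u v))) (fuv u v).
Proof.
intros Hu Huv C Hh Hp; apply is_lim_seq_Reals; intros eps Heps.
destruct (C (mkposreal eps Heps)) as [d Hd]; simpl in Hd.
apply is_lim_seq_Reals in Hh; destruct (Hh d (cond_pos d)) as [N HN].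
exists N; intros n Hge; specialize (HN n Hge); specialize (Hp n); unfold Rdist in *.
set (k := h n) in *; rewrite Rminus_0_r, Rabs_pos_eq in HN by lra.
destruct (MVT_cor2 (fun s => f s (v + k) - f s v) (fun s => fu s (v + k) - fu s v) u (u + k))
  as (s & Es & Hs); [lra | | ].
{ intros c _; apply derivable_pt_lim_minus; apply Hu. }
destruct (MVT_cor2 (fun t => fu s t) (fun t => fuv s t) v (v + k))
  as (t & Et & Ht); [lra | | ].
{ intros c _; apply Huv. }
replace (f (u + k) (v + k) - f u v - (f (u + k) v - f u v) - (f u (v + k) - f u v))
  with (f (u + k) (v + k) - f (u + k) v - (f u (v + k) - f u v)) by ring.
rewrite Es, Et.
replace (/ (k * k) * (fuv s t * (v + k - v) * (u + k - u))) with (fuv s t) by (field; lra).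
apply Hd; apply Rabs_def1; lra.
Qed.

(** [D i j] is the partial derivative of order i in u and j in v. Mixed partials commute by
    construction: [D 1 1] is the derivative of both [D 1 0] and [D 0 1]. *)
Definition jet (x : R -> R -> R3) (D : nat -> nat -> R -> R -> R3) : Prop :=
  (forall u v, D O O u v = x u v) /\
  forall i j u v, vcont (D i j) u v /\
    vderiv_lim (fun s => D i j s v) u (D (S i) j u v) /\
    vderiv_lim (fun t => D i j u t) v (D i (S j) u v).

Lemma smooth_surface_jet (x : R -> R -> R3) : smooth_surface x -> exists D, jet x D.
Proof.
intros ((D1 & E1 & H1) & (D2 & E2 & H2) & (D3 & E3 & H3)).
exists (fun i j u v => mkR3 (D1 i j u v) (D2 i j u v) (D3 i j u v)); split.
- intros u v; apply R3_ext; simpl; auto.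
- intros i j u v; destruct (H1 i j) as [C1 L1], (H2 i j) as [C2 L2], (H3 i j) as [C3 L3].
  assert (K : forall f, continuous2 f -> continuity_2d_pt f u v).
  { intros f C eps; destruct (C u v eps (cond_pos eps)) as (d & Hd & B).
    exists (mkposreal d Hd); exact B. }
  repeat split; simpl; first [apply K; assumption | apply L1 | apply L2 | apply L3].
Qed.

Lemma vderiv_lim_unique (f : R -> R3) (t : R) (l m : R3) :
  vderiv_lim f t l -> vderiv_lim f t m -> l = m.
Proof. intros (L1 & L2 & L3) (M1 & M2 & M3); apply R3_ext; eapply uniqueness_limite; eauto. Qed.

Lemma vderiv_lim_ext (f g : R -> R3) (t : R) (l : R3) :
  (forall s, f s = g s) -> vderiv_lim f t l -> vderiv_lim g t l.
Proof.
intros E (L1 & L2 & L3); repeat split; intros eps He;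
 [destruct (L1 eps He) as [d Hd] | destruct (L2 eps He) as [d Hd] | destruct (L3 eps He) as [d Hd]];
 exists d; intros h; rewrite <- !E; apply Hd.
Qed.

Section Jet.

Variables (x : R -> R -> R3) (D : nat -> nat -> R -> R -> R3).
Hypothesis J : jet x D.

Lemma jet_pdu (u v : R) : pdu x u v = D 1 0 u v.
Proof.
assert (K : vderiv_lim (fun s => x s v) u (D 1%nat O u v)).
{ apply vderiv_lim_ext with (fun s => D O O s v); [intros; apply J | apply J]. }
apply (vderiv_lim_unique (fun s => x s v) u); auto.
unfold pdu; apply epsilon_spec; eauto.
Qed.

Lemma jet_pdv (u v : R) : pdv x u v = D 0 1 u v.
Proof.
assert (K : vderiv_lim (fun t => x u t) v (D O 1%nat u v)).
{ apply vderiv_lim_ext with (fun t => D O O u t); [intros; apply J | apply J]. }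
apply (vderiv_lim_unique (fun t => x u t) v); auto.
unfold pdv; apply epsilon_spec; eauto.
Qed.

(** The two identities of [concyclic4_defect], for a square of side h, are divided by h^4 and h^6.
    The rescaled differences converge to x_u, x_v, x_uv, and the remaining terms carry a factor
    h. *)
Lemma jet_orthogonal_conjugate (u v : R) :
  (exists r, 0 < r /\ forall h, 0 < h <= r ->
     concyclic4 (x u v) (x (u + h) v) (x (u + h) (v + h)) (x u (v + h))) ->
  cross (D 1 0 u v) (D 0 1 u v) <> vzero ->
  dot (D 1 0 u v) (D 0 1 u v) = 0 /\
  dot (cross (D 1 0 u v) (D 0 1 u v)) (D 1 1 u v) = 0.
Proof.
intros (r & Hr & Q) Hn; destruct J as [J0 JD].
set (h := fun n => r * / (INR n + 1)).
assert (Hpos : forall n, 0 < h n <= r).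
{ intros n; pose proof (pos_INR n); unfold h.
  assert (0 < / (INR n + 1)) by (apply Rinv_0_lt_compat; lra).
  assert (/ (INR n + 1) <= 1) by (rewrite <- Rinv_1; apply Rinv_le_contravar; lra).
  nra. }
assert (Hlim : is_lim_seq h 0).
{ replace 0 with (r * 0) by ring; apply is_lim_seq_mult'; [apply is_lim_seq_const|].
  apply is_lim_seq_ext with (fun n => / (INR (S n))).
  - intros n; now rewrite S_INR.
  - apply (is_lim_seq_incr_1 (fun n => / INR n)).
    apply (is_lim_seq_inv INR p_infty); [apply is_lim_seq_INR | discriminate]. }
set (a := fun n => vscale (/ h n) (vsub (D 0 0 (u + h n) v) (D 0 0 u v))%nat).
set (b := fun n => vscale (/ h n) (vsub (D 0 0 u (v + h n)) (D 0 0 u v))%nat).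
set (e := fun n => vscale (/ (h n * h n)) (vsub (vsub (vsub (D 0 0 (u + h n) (v + h n)) (D 0 0 u v))
   (vsub (D 0 0 (u + h n) v) (D 0 0 u v))) (vsub (D 0 0 u (v + h n)) (D 0 0 u v)))%nat).
assert (Eq : forall n, let m := cross (a n) (b n) in dot m (e n) = 0 /\
  dot m m * (2 * dot (a n) (b n) + h n * (2 * dot (e n) (vadd (a n) (b n)) + h n * dot (e n) (e n))) =
  h n * (dot (cross (e n) (b n)) m * dot (a n) (a n) + dot (cross (a n) (e n)) m * dot (b n) (b n))).
{ intros n m; specialize (Hpos n).
  destruct (concyclic4_defect _ _ _ _ (Q (h n) Hpos)) as [E1 E2].
  rewrite <- !J0 in E1, E2.
  set (k := h n) in *.
  assert (Ea : vsub (D 0 0 (u + k) v)%nat (D 0 0 u v)%nat = vscale k (a n)).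
  { unfold a; fold k; apply R3_ext; simpl; field; lra. }
  assert (Eb : vsub (D 0 0 u (v + k))%nat (D 0 0 u v)%nat = vscale k (b n)).
  { unfold b; fold k; apply R3_ext; simpl; field; lra. }
  assert (Ee : vsub (vsub (vsub (D 0 0 (u + k) (v + k)) (D 0 0 u v))
   (vsub (D 0 0 (u + k) v) (D 0 0 u v))) (vsub (D 0 0 u (v + k)) (D 0 0 u v))%nat = vscale (k * k) (e n)).
  { unfold e; fold k; apply R3_ext; simpl; field; lra. }
  rewrite Ee, Ea, Eb in E1, E2; unfold m; clear Ea Eb Ee; set (a0 := a n) in *; set (b0 := b n) in *.
  set (e0 := e n) in *; clearbody a0 b0 e0 k; split.
  - apply (Rmult_eq_reg_l (k ^ 4)); [ | apply pow_nonzero; lra].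
    rewrite Rmult_0_r, <- E1; dring.
  - apply (Rmult_eq_reg_l (k ^ 6)); [ | apply pow_nonzero; lra].
    match type of E2 with ?l = ?r => transitivity l; [dring | transitivity r; [exact E2 | dring]] end. }
assert (La : vlim a (D 1 0 u v)%nat).
{ destruct (JD O O u v) as (_ & (L1 & L2 & L3) & _).
  repeat split; unfold a, vsub, vadd, vscale; cbn [c1 c2 c3].
  - eapply is_lim_seq_ext; [ | apply (derivable_pt_lim_seq _ _ _ h L1); auto; intros; specialize (Hpos n); lra].
    intros n; cbn beta; ring.
  - eapply is_lim_seq_ext; [ | apply (derivable_pt_lim_seq _ _ _ h L2); auto; intros; specialize (Hpos n); lra].
    intros n; cbn beta; ring.
  - eapply is_lim_seq_ext; [ | apply (derivable_pt_lim_seq _ _ _ h L3); auto; intros; specialize (Hpos n); lra].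
    intros n; cbn beta; ring. }
assert (Lb : vlim b (D 0 1 u v)%nat).
{ destruct (JD O O u v) as (_ & _ & (L1 & L2 & L3)).
  repeat split; unfold b, vsub, vadd, vscale; cbn [c1 c2 c3].
  - eapply is_lim_seq_ext; [ | apply (derivable_pt_lim_seq _ _ _ h L1); auto; intros; specialize (Hpos n); lra].
    intros n; cbn beta; ring.
  - eapply is_lim_seq_ext; [ | apply (derivable_pt_lim_seq _ _ _ h L2); auto; intros; specialize (Hpos n); lra].
    intros n; cbn beta; ring.
  - eapply is_lim_seq_ext; [ | apply (derivable_pt_lim_seq _ _ _ h L3); auto; intros; specialize (Hpos n); lra].
    intros n; cbn beta; ring. }
assert (Le : vlim e (D 1 1 u v)%nat).
{ assert (Hp : forall n, 0 < h n) by (intros n; apply Hpos).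
  destruct (JD 1 1 u v)%nat as ((C1 & C2 & C3) & _).
  repeat split; unfold e, vsub, vadd, vscale; cbn [c1 c2 c3].
  - eapply is_lim_seq_ext; [ | refine (mixed_difference_seq (fun s t => c1 (D 0 0 s t)%nat) (fun s t => c1 (D 1 0 s t)%nat)
      _ u v h _ _ C1 Hlim Hp); intros; apply JD]; intros n; cbn beta; ring.
  - eapply is_lim_seq_ext; [ | refine (mixed_difference_seq (fun s t => c2 (D 0 0 s t)%nat) (fun s t => c2 (D 1 0 s t)%nat)
      _ u v h _ _ C2 Hlim Hp); intros; apply JD]; intros n; cbn beta; ring.
  - eapply is_lim_seq_ext; [ | refine (mixed_difference_seq (fun s t => c3 (D 0 0 s t)%nat) (fun s t => c3 (D 1 0 s t)%nat)
      _ u v h _ _ C3 Hlim Hp); intros; apply JD]; intros n; cbn beta; ring. }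
assert (Lm := vlim_cross _ _ _ _ La Lb).
assert (U : forall s (l m : R), is_lim_seq s l -> is_lim_seq s m -> l = m).
{ intros s l m L1 L2; apply is_lim_seq_unique in L1; apply is_lim_seq_unique in L2; congruence. }
split.
- apply dot_self_pos in Hn.
  set (xu := D 1%nat 0%nat u v) in *; set (xv := D 0%nat 1%nat u v) in *; set (w := D 1%nat 1%nat u v) in *.
  assert (Z : dot (cross xu xv) (cross xu xv) *
     (2 * dot xu xv + 0 * (2 * dot w (vadd xu xv) + 0 * dot w w)) =
     0 * (dot (cross w xv) (cross xu xv) * dot xu xu + dot (cross xu w) (cross xu xv) * dot xv xv)).
  { eapply U.
    - apply is_lim_seq_mult'; [apply (vlim_dot _ _ _ _ Lm Lm)|].
      apply is_lim_seq_plus'; [apply is_lim_seq_mult'; [apply is_lim_seq_const | apply (vlim_dot _ _ _ _ La Lb)]|].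
      apply is_lim_seq_mult'; [exact Hlim|].
      apply is_lim_seq_plus'.
      + apply is_lim_seq_mult'; [apply is_lim_seq_const | apply (vlim_dot _ _ _ _ Le (vlim_vadd _ _ _ _ La Lb))].
      + apply is_lim_seq_mult'; [exact Hlim | apply (vlim_dot _ _ _ _ Le Le)].
    - eapply is_lim_seq_ext; [intros n; symmetry; apply Eq|].
      apply is_lim_seq_mult'; [exact Hlim|].
      apply is_lim_seq_plus'; apply is_lim_seq_mult'.
      + apply (vlim_dot _ _ _ _ (vlim_cross _ _ _ _ Le Lb) Lm).
      + apply (vlim_dot _ _ _ _ La La).
      + apply (vlim_dot _ _ _ _ (vlim_cross _ _ _ _ La Le) Lm).
      + apply (vlim_dot _ _ _ _ Lb Lb). }
  rewrite !Rmult_0_l, Rplus_0_r in Z; apply Rmult_integral in Z; lra.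
- eapply U; [apply (vlim_dot _ _ _ _ Lm Le)|].
  eapply is_lim_seq_ext; [intros n; symmetry; apply Eq | apply is_lim_seq_const].
Qed.

End Jet.

(** * Curvature lines *)

Lemma deriv_dot (f g : R -> R3) (t : R) (l m : R3) : vderiv_lim f t l -> vderiv_lim g t m ->
  derivable_pt_lim (fun s => dot (f s) (g s)) t (dot l (g t) + dot (f t) m).
Proof.
intros (F1 & F2 & F3) (G1 & G2 & G3).
pose proof (derivable_pt_lim_plus _ _ _ _ _ (derivable_pt_lim_plus _ _ _ _ _
  (derivable_pt_lim_mult _ _ _ _ _ F1 G1) (derivable_pt_lim_mult _ _ _ _ _ F2 G2))
  (derivable_pt_lim_mult _ _ _ _ _ F3 G3)) as K.
replace (dot l (g t) + dot (f t) m) with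
  (c1 l * c1 (g t) + c1 (f t) * c1 m + (c2 l * c2 (g t) + c2 (f t) * c2 m)
   + (c3 l * c3 (g t) + c3 (f t) * c3 m)) by (unfold dot; ring).
exact K.
Qed.

Lemma vderiv_vscale (k : R -> R) (f : R -> R3) (t k' : R) (l : R3) :
  derivable_pt_lim k t k' -> vderiv_lim f t l ->
  vderiv_lim (fun s => vscale (k s) (f s)) t (vadd (vscale k' (f t)) (vscale (k t) l)).
Proof.
intros K (F1 & F2 & F3); repeat split; simpl.
- exact (derivable_pt_lim_mult _ _ _ _ _ K F1).
- exact (derivable_pt_lim_mult _ _ _ _ _ K F2).
- exact (derivable_pt_lim_mult _ _ _ _ _ K F3).
Qed.

Lemma vderiv_vadd (f g : R -> R3) (t : R) (l m : R3) : vderiv_lim f t l -> vderiv_lim g t m ->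
  vderiv_lim (fun s => vadd (f s) (g s)) t (vadd l m).
Proof.
intros (F1 & F2 & F3) (G1 & G2 & G3); repeat split; simpl.
- exact (derivable_pt_lim_plus _ _ _ _ _ F1 G1).
- exact (derivable_pt_lim_plus _ _ _ _ _ F2 G2).
- exact (derivable_pt_lim_plus _ _ _ _ _ F3 G3).
Qed.

Lemma vderiv_const (a : R3) (t : R) : vderiv_lim (fun _ => a) t vzero.
Proof. repeat split; apply derivable_pt_lim_const. Qed.

Lemma vderiv_vsub (f g : R -> R3) (t : R) (l m : R3) : vderiv_lim f t l -> vderiv_lim g t m ->
  vderiv_lim (fun s => vsub (f s) (g s)) t (vsub l m).
Proof.
intros F G; apply vderiv_vadd; auto.
replace (vscale (-1) m) with (vadd (vscale 0 (g t)) (vscale (-1) m)) by vring.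
apply (vderiv_vscale (fun _ => -1)); auto; apply derivable_pt_lim_const.
Qed.

Lemma vderiv_cross (f g : R -> R3) (t : R) (l m : R3) : vderiv_lim f t l -> vderiv_lim g t m ->
  vderiv_lim (fun s => cross (f s) (g s)) t (vadd (cross l (g t)) (cross (f t) m)).
Proof.
intros (F1 & F2 & F3) (G1 & G2 & G3).
assert (K : forall a b c d a' b' c' d', derivable_pt_lim a t a' -> derivable_pt_lim b t b' ->
  derivable_pt_lim c t c' -> derivable_pt_lim d t d' ->
  derivable_pt_lim (fun s => a s * b s - c s * d s) t
    ((a' * b t - c' * d t) + (a t * b' - c t * d'))).
{ intros a b c d a' b' c' d' Ha Hb Hc Hd.
  replace ((a' * b t - c' * d t) + (a t * b' - c t * d'))
    with ((a' * b t + a t * b') - (c' * d t + c t * d')) by ring.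
  exact (derivable_pt_lim_minus _ _ _ _ _ (derivable_pt_lim_mult _ _ _ _ _ Ha Hb)
    (derivable_pt_lim_mult _ _ _ _ _ Hc Hd)). }
repeat split; simpl; now apply K.
Qed.

Lemma derivable_pt_lim_Rinv (f : R -> R) (t l : R) : derivable_pt_lim f t l -> f t <> 0 ->
  derivable_pt_lim (fun s => / f s) t (- l / f t ^ 2).
Proof. intros H Hn; apply is_derive_Reals; apply is_derive_inv; auto; now apply is_derive_Reals. Qed.

Lemma derivable_pt_lim_eq0 (f : R -> R) (t l d : R) : derivable_pt_lim f t l -> 0 < d ->
  (forall s, t - d < s < t + d -> f s = 0) -> l = 0.
Proof.
intros H Hd Z; apply cond_eq; intros eps He.
destruct (H eps He) as [e Pe].
set (h := Rmin d e / 2).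
assert (0 < Rmin d e) by (apply Rmin_glb_lt; [auto | apply cond_pos]).
pose proof (Rmin_l d e); pose proof (Rmin_r d e).
specialize (Pe h ltac:(unfold h; lra) ltac:(unfold h; apply Rabs_def1; lra)).
rewrite !Z in Pe by (unfold h; lra).
replace ((0 - 0) / h - l) with (- (l - 0)) in Pe by (field; unfold h; lra).
now rewrite Rabs_Ropp in Pe.
Qed.

(** The derivative of the normalized vector is orthogonal to [w] and lies in the span of [w] and
    [w']. The last clause records the latter without a formula. *)
Lemma vderiv_normalize (w : R -> R3) (t : R) (w' : R3) : vderiv_lim w t w' -> w t <> vzero ->
  exists l, vderiv_lim (fun s => vscale (/ vnorm (w s)) (w s)) t l /\
    dot l (w t) = 0 /\ forall d, dot (w t) d = 0 -> dot w' d = 0 -> dot l d = 0.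
Proof.
intros H Hn; pose proof (dot_self_pos _ Hn) as P.
assert (Pn : 0 < vnorm (w t)) by now apply sqrt_lt_R0.
assert (En : vnorm (w t) ^ 2 = dot (w t) (w t))
  by (unfold vnorm; rewrite <- Rsqr_pow2; apply Rsqr_sqrt; lra).
assert (K : derivable_pt_lim (fun s => / vnorm (w s)) t
  (- (/ (2 * vnorm (w t)) * (dot w' (w t) + dot (w t) w')) / vnorm (w t) ^ 2)).
{ apply derivable_pt_lim_Rinv; [ | lra].
  exact (derivable_pt_lim_comp _ _ _ _ _ (deriv_dot _ _ _ _ _ H H) (derivable_pt_lim_sqrt _ P)). }
eexists; split; [exact (vderiv_vscale _ _ _ _ _ K H)|].
cbv beta; set (r := vnorm (w t)) in *; split.
- match goal with |- dot (vadd (vscale ?a _) _) _ = _ =>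
    transitivity (a * dot (w t) (w t) + / r * dot w' (w t)); [dring|] end.
  replace (dot (w t) w') with (dot w' (w t)) by dring.
  rewrite <- En; field; lra.
- intros d D1 D2.
  match goal with |- dot (vadd (vscale ?a _) _) _ = _ =>
    transitivity (a * dot (w t) d + / r * dot w' d); [dring|] end.
  rewrite D1, D2; ring.
Qed.

Lemma parallel_of_orthogonal_frame (p q l : R3) : cross p q <> vzero -> dot p q = 0 ->
  dot l (cross p q) = 0 -> dot l q = 0 -> exists k, l = vscale k p.
Proof.
intros N O L1 L2.
assert (Hp : p <> vzero) by (intros ->; apply N; vring).
assert (Hq : q <> vzero) by (intros ->; apply N; vring).
exists (dot l p / dot p p); apply cross_eq0_parallel; auto.
apply (cross_eq0_of_perp q (cross p q)).
- replace (cross q (cross p q)) with (vsub (vscale (dot q q) p) (vscale (dot p q) q)) by vring.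
  rewrite O; apply dot_pos_neq0.
  replace (dot _ _) with (dot q q * dot q q * dot p p) by dring.
  apply dot_self_pos in Hp, Hq; repeat apply Rmult_lt_0_compat; auto.
- rewrite <- L2; dring.
- rewrite <- L1; dring.
- rewrite <- O; dring.
- dring.
Qed.

(** The differential of [inv0] at [f], applied to [d]. *)
Definition dinv0 (f d : R3) : R3 :=
  vsub (vscale (/ dot f f) d) (vscale (2 * dot f d / dot f f ^ 2) f).

Lemma vderiv_inv0 (f : R -> R3) (t : R) (l : R3) : vderiv_lim f t l -> f t <> vzero ->
  vderiv_lim (fun s => inv0 (f s)) t (dinv0 (f t) l).
Proof.
intros H Hn; apply dot_self_pos in Hn.
pose proof (vderiv_vscale _ _ _ _ _ (derivable_pt_lim_Rinv _ _ _ (deriv_dot _ _ _ _ _ H H)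
  ltac:(lra)) H) as K.
match type of K with vderiv_lim _ _ ?m => replace (dinv0 (f t) l) with m; auto end.
unfold dinv0; replace (dot l (f t)) with (dot (f t) l) by dring.
apply R3_ext; simpl; field; lra.
Qed.

(** Inversion is conformal: inner products are divided by |f|^4, so Lagrange's identity carries
    linear dependence back. *)
Lemma dinv0_cross (f d1 d2 : R3) : f <> vzero ->
  cross (dinv0 f d1) (dinv0 f d2) = vzero -> cross d1 d2 = vzero.
Proof.
intros Hf E; apply dot_self_pos in Hf.
assert (C : forall a b, dot (dinv0 f a) (dinv0 f b) = dot a b / dot f f ^ 2).
{ intros a b; unfold dinv0; set (F := dot f f).
  transitivity (dot a b / F ^ 2 - 4 * dot f a * dot f b / F ^ 3
     + 4 * dot f a * dot f b / F ^ 4 * dot f f).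
  - vunfold; field; unfold F; lra.
  - fold F; field; unfold F; lra. }
assert (L : forall a b, dot (cross a b) (cross a b) = dot a a * dot b b - dot a b ^ 2) by dring.
assert (Z := L (dinv0 f d1) (dinv0 f d2)); rewrite E, !C in Z.
apply dot_self_eq0; rewrite L.
replace (dot vzero vzero) with 0 in Z by (unfold vzero; dring).
set (F := dot f f) in *.
transitivity (F ^ 4 * (dot d1 d1 / F ^ 2 * (dot d2 d2 / F ^ 2) - (dot d1 d2 / F ^ 2) ^ 2));
 [field; lra | rewrite <- Z; ring].
Qed.

Section Regular.

Variables (x : R -> R -> R3) (D : nat -> nat -> R -> R -> R3).
Hypothesis J : jet x D.
Hypothesis Hreg : forall u v, in_square u v -> cross (D 1 0 u v)%nat (D 0 1 u v)%nat <> vzero.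
Hypothesis Hcirc : forall u0 u1 v0 v1, 0 <= u0 -> u0 < u1 -> u1 <= 1 ->
  0 <= v0 -> v0 < v1 -> v1 <= 1 ->
  concyclic4 (x u0 v0) (x u1 v0) (x u1 v1) (x u0 v1).

Lemma patch_orthogonal_conjugate (u v : R) : in_square u v ->
  dot (D 1 0 u v) (D 0 1 u v)%nat = 0 /\
  dot (cross (D 1 0 u v) (D 0 1 u v)) (D 1 1 u v)%nat = 0.
Proof.
intros S.
assert (K : forall s t, 0 < s < 1 -> 0 < t < 1 ->
  dot (D 1 0 s t) (D 0 1 s t)%nat = 0 /\
  dot (cross (D 1 0 s t) (D 0 1 s t)) (D 1 1 s t)%nat = 0).
{ intros s t Hs Ht; apply (jet_orthogonal_conjugate x); auto.
  - exists (Rmin (1 - s) (1 - t)); split; [apply Rmin_glb_lt; lra|].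
    intros h Hh; pose proof (Rmin_l (1 - s) (1 - t)); pose proof (Rmin_r (1 - s) (1 - t)).
    apply Hcirc; lra.
  - apply Hreg; unfold in_square; lra. }
destruct J as [_ JD].
split.
- apply (continuity_2d_eq0_closure (fun s t => dot (D 1 0 s t) (D 0 1 s t)%nat)); auto.
  + apply continuity_dot; apply JD.
  + intros; now apply K.
- apply (continuity_2d_eq0_closure (fun s t => dot (cross (D 1 0 s t) (D 0 1 s t)) (D 1 1 s t)%nat)); auto.
  + apply continuity_dot; [apply vcont_cross | ]; apply JD.
  + intros; now apply K.
Qed.

Lemma unit_normal_jet (u v : R) : unit_normal x u v =
  vscale (/ vnorm (cross (D 1 0 u v) (D 0 1 u v)%nat)) (cross (D 1 0 u v) (D 0 1 u v)%nat).
Proof. unfold unit_normal; rewrite (jet_pdu x D J), (jet_pdv x D J); reflexivity. Qed.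

(** Up to a factor, n_u.x_v is det(x_u, x_v, x_uv), which is zero. Thus n_u is orthogonal to n and
    to x_v, hence parallel to x_u in the orthogonal frame. *)
Lemma parameter_lines_principal (u v : R) : in_square u v ->
  u_principal x u v /\ v_principal x u v.
Proof.
intros S; pose proof (Hreg u v S) as N.
destruct (patch_orthogonal_conjugate u v S) as [O M].
destruct J as [_ JD]; split.
- unfold u_principal; rewrite (jet_pdu x D J).
  destruct (vderiv_normalize (fun s => cross (D 1 0 s v) (D 0 1 s v)%nat) u _
    (vderiv_cross _ _ _ _ _ (proj1 (proj2 (JD 1%nat 0%nat u v))) (proj1 (proj2 (JD 0%nat 1%nat u v)))) N)
    as (l & L & L1 & L2).
  destruct (parallel_of_orthogonal_frame (D 1 0 u v) (D 0 1 u v) l)%nat as (k & E); auto.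
  + apply L2; [dring|].
    transitivity (- dot (cross (D 1 0 u v) (D 0 1 u v)) (D 1 1 u v)%nat); [dring | rewrite M; ring].
  + exists k; rewrite <- E; eapply vderiv_lim_ext; [intros s; symmetry; apply unit_normal_jet | exact L].
- unfold v_principal; rewrite (jet_pdv x D J).
  destruct (vderiv_normalize (fun s => cross (D 1 0 u s) (D 0 1 u s)%nat) v _
    (vderiv_cross _ _ _ _ _ (proj2 (proj2 (JD 1%nat 0%nat u v))) (proj2 (proj2 (JD 0%nat 1%nat u v)))) N)
    as (l & L & L1 & L2).
  destruct (parallel_of_orthogonal_frame (D 0 1 u v) (D 1 0 u v) l)%nat as (k & E).
  + intros F; apply N; replace (cross _ _) with (vscale (-1) (cross (D 0 1 u v) (D 1 0 u v)%nat)) by vring.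
    rewrite F; vring.
  + rewrite <- O; dring.
  + transitivity (- dot l (cross (D 1 0 u v) (D 0 1 u v)%nat)); [dring|].
    cbv beta in L1; rewrite L1; ring.
  + apply L2; [dring|].
    transitivity (- dot (cross (D 1 0 u v) (D 0 1 u v)) (D 1 1 u v)%nat); [dring | rewrite M; ring].
  + exists k; rewrite <- E; eapply vderiv_lim_ext; [intros s; symmetry; apply unit_normal_jet | exact L].
Qed.

(** On a piece whose inverse lies on a line, both partial derivatives of the inverse are parallel to
    [d]. By [dinv0_cross], x_u and x_v are then dependent, against regularity. *)
Lemma regular_circular_patch :
  (forall u v u' v', in_square u v -> in_square u' v' -> x u v = x u' v' -> u = u' /\ v = v') ->
  circular_patch x.
Proof.
intros I; split; [|split; [|split]]; auto.
- intros u v; destruct J as [J0 JD]; destruct (JD O O u v) as (C & _).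
  destruct C as (C1 & C2 & C3).
  split; [|split].
  + exact (continuity_2d_pt_ext _ _ _ _ (fun s t => f_equal c1 (J0 s t)) C1).
  + exact (continuity_2d_pt_ext _ _ _ _ (fun s t => f_equal c2 (J0 s t)) C2).
  + exact (continuity_2d_pt_ext _ _ _ _ (fun s t => f_equal c3 (J0 s t)) C3).
- intros o p d u0 u1 v0 v1 H1 H2 H3 H4 H5 H6 Hd K.
  set (u := (u0 + u1) / 2); set (v := (v0 + v1) / 2).
  assert (Hu : u0 < u < u1) by (unfold u; lra); assert (Hv : v0 < v < v1) by (unfold v; lra).
  apply (Hreg u v); [unfold in_square; lra|].
  destruct J as [J0 JD].
  assert (No : vsub (D 0 0 u v)%nat o <> vzero).
  { rewrite J0; apply vsub_neq0; now apply K. }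
  apply (dinv0_cross _ _ _ No).
  assert (Z : forall (f : R -> R3) t l r, vderiv_lim f t l -> 0 < r -> vsub (f t) o <> vzero ->
     (forall s, t - r < s < t + r -> cross (vsub (inv0 (vsub (f s) o)) p) d = vzero) ->
     cross (dinv0 (vsub (f t) o) l) d = vzero).
  { intros f t l r Hf Hr Hn Hz.
    assert (G := vderiv_cross _ _ _ _ _ (vderiv_vsub _ _ _ _ _
      (vderiv_inv0 _ _ _ (vderiv_vsub _ _ _ _ _ Hf (vderiv_const o t)) Hn) (vderiv_const p t))
      (vderiv_const d t)).
    cbv beta in G.
    set (m := dinv0 (vsub (f t) o) (vsub l vzero)) in G.
    replace (dinv0 (vsub (f t) o) l) with m by (unfold m; f_equal; vring).
    assert (G0 : vadd (cross (vsub m vzero) d) (cross (vsub (inv0 (vsub (f t) o)) p) vzero) = cross m d)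
      by vring.
    rewrite G0 in G; destruct G as (G1 & G2 & G3).
    apply R3_ext; eapply derivable_pt_lim_eq0; eauto; intros s Hs; cbv beta; rewrite Hz; auto. }
  assert (Zu := Z _ _ _ (u1 - u) (proj1 (proj2 (JD O O u v))) ltac:(lra) No).
  assert (Zv := Z _ _ _ (v1 - v) (proj2 (proj2 (JD O O u v))) ltac:(lra) No).
  cbv beta in Zu, Zv.
  rewrite (cross_eq0_parallel _ _ (Zu ltac:(intros s Hs; rewrite J0; apply K; unfold u in *; lra)) Hd).
  rewrite (cross_eq0_parallel _ _ (Zv ltac:(intros s Hs; rewrite J0; apply K; unfold v in *; lra)) Hd).
  vring.
Qed.

End Regular.

(** * The pencil of spheres *)

(** Relative to [m], the point [y] is the inverse of [b] in the sphere with center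
    [al u * e] and power [al u ^ 2 + c]; these spheres form a pencil. *)
Definition axial (x : R -> R -> R3) : Prop :=
  exists (m e : R3) (c : R) (al : R -> R), dot e e = 1 /\
  (forall u, 0 < u <= 1 -> invpt x 0 0 u 0 = vadd m (vscale (al u) e) /\ 0 < al u ^ 2 + c) /\
  forall v, 0 < v <= 1 -> let b := vsub (invpt x 0 0 0 v) m in
    dot e b = 0 /\ 0 < dot b b - c /\
    forall u, 0 < u <= 1 -> let y := vsub (invpt x 0 0 u v) m in
    exists t s, 0 < t /\ y = vadd (vscale t b) (vscale s e) /\
      dot y y + c = t * (dot b b + c).

Lemma invpt_dist (x : R -> R -> R3) (u v : R) : circular_patch x -> 0 < u <= 1 -> 0 < v <= 1 ->
  dot (vsub (invpt x 0 0 0 v) (invpt x 0 0 u 0)) (vsub (invpt x 0 0 0 v) (invpt x 0 0 u 0)) =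
  ipow x 0 0 1 v + ipow (fun s t => x t s) 0 0 1 u.
Proof.
intros P Hu Hv.
rewrite (ipow_const x P 0 0 ltac:(lra) ltac:(lra) 1 u v) by lra.
rewrite (ipow_const _ (circular_patch_swap x P) 0 0 ltac:(lra) ltac:(lra) 1 v u) by lra.
destruct (invpt_on_line x P 0 0 ltac:(lra) ltac:(lra) u v Hu Hv) as (t & E & _ & _ & ->).
unfold ipow; change (invpt (fun s t => x t s) 0 0 v u) with (invpt x 0 0 u v).
change (invpt (fun s t => x t s) 0 0 0 u) with (invpt x 0 0 u 0).
change (invpt (fun s t => x t s) 0 0 v 0) with (invpt x 0 0 0 v).
rewrite E; dring.
Qed.

Lemma invpt_orthogonal (x : R -> R -> R3) (u u' v v' : R) : circular_patch x ->
  0 < u <= 1 -> 0 < u' <= 1 -> 0 < v <= 1 -> 0 < v' <= 1 ->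
  dot (vsub (invpt x 0 0 u 0) (invpt x 0 0 u' 0)) (vsub (invpt x 0 0 0 v) (invpt x 0 0 0 v')) = 0.
Proof.
intros P Hu Hu' Hv Hv'.
pose proof (invpt_dist x u v P Hu Hv); pose proof (invpt_dist x u' v P Hu' Hv).
pose proof (invpt_dist x u v' P Hu Hv'); pose proof (invpt_dist x u' v' P Hu' Hv').
set (a := invpt x 0 0 u 0) in *; set (a' := invpt x 0 0 u' 0) in *.
set (b := invpt x 0 0 0 v) in *; set (b' := invpt x 0 0 0 v') in *.
assert (E : 2 * dot (vsub a a') (vsub b b') =
  dot (vsub b a') (vsub b a') + dot (vsub b' a) (vsub b' a)
  - dot (vsub b a) (vsub b a) - dot (vsub b' a') (vsub b' a')) by dring.
lra.
Qed.

(** [m] is the point where the line of a(u) meets the orthogonal plane of b(v). By Pythagoras |b -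
    m|^2 + al^2 = rh + sg, so sg - al^2 and |b - m|^2 - rh equal one constant [c]. Positivity of
    both powers gives 0 < t. *)
Lemma axial_of_collinear (x : R -> R -> R3) : circular_patch x ->
  (forall u, 0 < u <= 1 -> cross (vsub (invpt x 0 0 u 0) (invpt x 0 0 1 0))
     (vsub (invpt x 0 0 (/ 2) 0) (invpt x 0 0 1 0)) = vzero) -> axial x.
Proof.
intros P Hc.
set (a := fun u => invpt x 0 0 u 0); set (b := fun v => invpt x 0 0 0 v).
set (w := vsub (a (/ 2)) (a 1)).
assert (Nw : w <> vzero).
{ apply vsub_neq0, invpt_neq; auto; try (left; lra); unfold in_square; lra. }
assert (Lp : 0 < vnorm w) by now apply sqrt_lt_R0, dot_self_pos.
assert (Ll : vnorm w * vnorm w = dot w w) by (apply sqrt_sqrt, dot_self_ge0).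
set (l := vnorm w) in *.
set (e := vscale (/ l) w).
assert (Ee : dot e e = 1).
{ transitivity (/ l * / l * dot w w); [unfold e; dring | rewrite <- Ll; field; lra]. }
assert (Ew : vscale l e = w).
{ transitivity (vscale (l * / l) w); [unfold e; vring | rewrite Rinv_r by lra; vring]. }
set (m := vadd (a 1) (vscale (dot e (vsub (b 1) (a 1))) e)).
set (al := fun u => dot e (vsub (a u) m)).
assert (Ea : forall u, 0 < u <= 1 -> a u = vadd m (vscale (al u) e)).
{ intros u Hu; pose proof (cross_eq0_parallel _ _ (Hc u Hu) Nw) as E.
  change (invpt x 0 0 u 0) with (a u) in E; change (invpt x 0 0 1 0) with (a 1) in E.
  set (k := _ / _) in E.
  assert (E1 : vsub (a u) m = vscale (k * l - dot e (vsub (b 1) (a 1))) e).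
  { transitivity (vsub (vsub (a u) (a 1)) (vscale (dot e (vsub (b 1) (a 1))) e));
      [unfold m; vring|].
    rewrite E; replace (vsub (invpt x 0 0 (/ 2) 0) (a 1)) with (vscale l e).
    vring. }
  unfold al; rewrite E1.
  replace (dot e (vscale (k * l - dot e (vsub (b 1) (a 1))) e))
    with ((k * l - dot e (vsub (b 1) (a 1))) * dot e e) by dring.
  rewrite Ee, Rmult_1_r, <- E1; vring. }
assert (Eb : forall v, 0 < v <= 1 -> dot e (vsub (b v) m) = 0).
{ intros v Hv.
  pose proof (invpt_orthogonal x (/ 2) 1 v 1 P ltac:(lra) ltac:(lra) Hv ltac:(lra)) as O.
  change (dot w (vsub (b v) (b 1)) = 0) in O.
  transitivity (/ l * dot w (vsub (b v) (b 1)) + dot e (vsub (b 1) (a 1)) * (1 - dot e e)).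
  - unfold m; replace (/ l * dot w (vsub (b v) (b 1))) with (dot e (vsub (b v) (b 1))) by (unfold e; dring).
    clearbody e; dring.
  - rewrite O, Ee; ring. }
set (sg := fun u => ipow (fun s t => x t s) 0 0 1 u); set (rh := fun v => ipow x 0 0 1 v).
assert (Dist : forall u v, 0 < u <= 1 -> 0 < v <= 1 ->
   dot (vsub (b v) m) (vsub (b v) m) + al u ^ 2 = rh v + sg u).
{ intros u v Hu Hv; unfold rh, sg; rewrite <- invpt_dist by auto.
  fold (a u); fold (b v); rewrite (Ea u Hu).
  transitivity (dot (vsub (b v) m) (vsub (b v) m) - 2 * al u * dot e (vsub (b v) m) + al u ^ 2 * dot e e);
    [rewrite Ee, Eb by auto; ring | clearbody e m al; dring]. }
set (c := sg 1 - al 1 ^ 2).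
assert (Es : forall u, 0 < u <= 1 -> sg u = al u ^ 2 + c).
{ intros u Hu; pose proof (Dist u 1 Hu ltac:(lra)); pose proof (Dist 1 1 ltac:(lra) ltac:(lra)).
  unfold c; lra. }
assert (Er : forall v, 0 < v <= 1 -> rh v = dot (vsub (b v) m) (vsub (b v) m) - c).
{ intros v Hv; pose proof (Dist 1 v ltac:(lra) Hv); pose proof (Es 1 ltac:(lra)); lra. }
exists m, e, c, al; split; [exact Ee | split].
- intros u Hu; split; [now apply Ea|]; rewrite <- Es by auto.
  apply ipow_pos; try lra; now apply circular_patch_swap.
- intros v Hv b0; repeat split.
  + now apply Eb.
  + change (0 < dot (vsub (b v) m) (vsub (b v) m) - c); rewrite <- Er by auto.
    apply ipow_pos; auto; lra.
  + intros u Hu y.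
    destruct (invpt_on_line x P 0 0 ltac:(lra) ltac:(lra) u v Hu Hv) as (t & E & _ & _ & W).
    change (invpt x 0 0 u 0) with (a u) in *; change (invpt x 0 0 0 v) with (b v) in *.
    assert (N := Dist u v Hu Hv).
    rewrite (ipow_const x P 0 0 ltac:(lra) ltac:(lra) u 1 v) in W by lra; fold (rh v) in W.
    assert (D2 : dot (vsub (b v) (a u)) (vsub (b v) (a u)) = rh v + sg u)
      by (unfold rh, sg; rewrite <- invpt_dist by auto; reflexivity).
    rewrite D2 in W.
    assert (Sp : 0 < sg u).
    { apply ipow_pos; try lra; now apply circular_patch_swap. }
    assert (Rp : 0 < rh v) by (apply ipow_pos; auto; lra).
    assert (Et : t * (rh v + sg u) = sg u) by lra.
    assert (Ey : y = vadd (vscale t b0) (vscale ((1 - t) * al u) e)).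
    { unfold y, b0; rewrite E, (Ea u Hu); change (invpt x 0 0 0 v) with (b v); vring. }
    exists t, ((1 - t) * al u); split; [nra | split; auto].
    rewrite Ey.
    transitivity (t ^ 2 * dot b0 b0 + 2 * t * ((1 - t) * al u) * dot e b0 + ((1 - t) * al u) ^ 2 * dot e e + c);
      [dring|].
    pose proof (Eb v Hv) as O; change (dot e b0 = 0) in O; rewrite O, Ee.
    change (dot b0 b0 + al u ^ 2 = rh v + sg u) in N.
    rewrite <- N, (Es u Hu) in Et.
    replace c with (t * (dot b0 b0 + al u ^ 2) - al u ^ 2) by lra; ring.
Qed.

(** If the points a(u) are not collinear, the differences of the b(v) are orthogonal to two
    independent vectors, so the b(v) are collinear. *)
Lemma axial_or_swap (x : R -> R -> R3) : circular_patch x ->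
  axial x \/ axial (fun u v => x v u).
Proof.
intros P.
set (a := fun u => vsub (invpt x 0 0 u 0) (invpt x 0 0 1 0)).
destruct (classic (forall u, 0 < u <= 1 -> cross (a u) (a (/ 2)) = vzero)) as [H | H].
- left; now apply axial_of_collinear.
- right; apply axial_of_collinear; [now apply circular_patch_swap|].
  apply not_all_ex_not in H; destruct H as [u H]; apply imply_to_and in H; destruct H as [Hu H].
  intros v Hv; apply (cross_eq0_of_perp _ _ _ _ H);
    apply (invpt_orthogonal x); auto; lra.
Qed.

(** The special conformal transformation, [inv0] conjugating the translation by
    [- q]; this form is also valid at points which [inv0] sends to infinity. *)
Definition sctden (q d : R3) : R := 1 - 2 * dot q d + dot q q * dot d d.
Definition sct (q d : R3) : R3 := vscale (/ sctden q d) (vsub d (vscale (dot d d) q)).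

Lemma sctden_inv0 (q d : R3) : d <> vzero ->
  sctden q d = dot d d * dot (vsub (inv0 d) q) (vsub (inv0 d) q).
Proof.
intros H; apply dot_self_pos in H; unfold inv0.
transitivity (dot d d * (/ dot d d * / dot d d * dot d d - 2 * / dot d d * dot q d + dot q q));
  [unfold sctden; field; lra | set (k := / dot d d); dring].
Qed.

Lemma sct_inv0 (q d : R3) : d <> vzero -> inv0 d <> q -> sct q d = inv0 (vsub (inv0 d) q).
Proof.
intros H Hq; unfold sct; rewrite sctden_inv0 by exact H.
apply vsub_neq0, dot_self_pos in Hq; apply dot_self_pos in H.
unfold inv0 at 3; set (N := dot (vsub (inv0 d) q) (vsub (inv0 d) q)) in *.
unfold inv0; apply R3_ext; simpl; field; lra.
Qed.

Lemma sct_mobius (o q : R3) : exists l, mobius l /\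
  forall p, sctden q (vsub p o) <> 0 -> mob_maps l (vadd o (sct q (vsub p o))) p.
Proof.
destruct (classic (q = vzero)) as [-> | Hq].
- exists nil; split; [constructor|]; intros p _; simpl.
  unfold sct; replace (sctden vzero (vsub p o)) with 1 by (unfold sctden, vzero; dring).
  rewrite Rinv_1; vring.
- apply dot_self_pos in Hq; set (l := sqrt (dot q q)).
  assert (Lp : 0 < l) by now apply sqrt_lt_R0.
  assert (Ll : dot q q = l * l) by (symmetry; apply sqrt_sqrt; lra).
  (* The translation by [q] is the product of the reflections in q.y = 0 and q.y = |q|^2/2.
     Conjugation by [inv0] keeps the first plane and turns the second into the sphere through the
     origin with center q/|q|^2 and radius 1/|q|. Both fix [o], so no step sends the corner to
     infinity. *)
  exists (PlaneRefl (vscale (/ l) q) (dot (vscale (/ l) q) o) ::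
     SphInv (vadd o (vscale (/ dot q q) q)) (/ l) :: nil); split.
  + repeat constructor; simpl; [ | now apply Rinv_0_lt_compat].
    transitivity (/ l * / l * dot q q); [dring | rewrite Ll; field; lra].
  + intros p Hd; set (d := vsub p o) in *.
    unfold mob_maps, gs_defined, gs_apply; split; auto.
    set (z := vsub (vadd o (sct q d)) _).
    assert (Ez : vsub z (vadd o (vscale (/ dot q q) q)) =
       vscale (/ sctden q d) (vsub d (vscale (/ dot q q) q))).
    { transitivity (vsub (sct q d) (vscale (2 * / l * / l * dot q (sct q d) + / dot q q) q));
        [unfold z; vring|].
      assert (Eq : dot q (sct q d) = (dot q d - dot d d * dot q q) / sctden q d)
        by (unfold sct, Rdiv; dring).
      rewrite Eq; unfold sct; replace (/ l * / l) with (/ dot q q) by (rewrite Ll; field; lra).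
      replace (2 * / l * / l) with (2 * / dot q q) by (rewrite Ll; field; lra).
      set (S := sctden q d) in *.
      assert (E3 : dot q d = (1 + dot q q * dot d d - S) / 2) by (unfold S, sctden; field).
      rewrite E3; apply R3_ext; simpl; field; lra. }
    assert (En : dot (vsub d (vscale (/ dot q q) q)) (vsub d (vscale (/ dot q q) q)) = sctden q d / dot q q).
    { transitivity (dot d d - 2 * / dot q q * dot q d + / dot q q * / dot q q * dot q q);
        [set (k := / dot q q); dring | unfold sctden; field; lra]. }
    assert (EN : dot (vsub z (vadd o (vscale (/ dot q q) q))) (vsub z (vadd o (vscale (/ dot q q) q)))
       = / (dot q q * sctden q d)).
    { rewrite Ez; transitivity (/ sctden q d * / sctden q d *
        dot (vsub d (vscale (/ dot q q) q)) (vsub d (vscale (/ dot q q) q)));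
       [set (k := / sctden q d); dring | rewrite En; field; lra]. }
    split.
    * intros F; rewrite F in EN.
      replace (dot (vsub _ _) _) with 0 in EN by dring.
      symmetry in EN; revert EN; apply Rinv_neq_0_compat, Rmult_integral_contrapositive; lra.
    * rewrite EN, Ez; transitivity (vadd o d); [unfold d; vring|].
      replace ((/ l) ^ 2) with (/ dot q q) by (rewrite Ll; field; lra).
      apply R3_ext; simpl; field; lra.
Qed.

(** Conformality of [sct q], with scale factor [/ sctden]. *)
Lemma vderiv_sct (q : R3) (f : R -> R3) (t : R) (l : R3) : vderiv_lim f t l ->
  sctden q (f t) <> 0 ->
  exists m, vderiv_lim (fun s => sct q (f s)) t m /\ dot m m * sctden q (f t) ^ 2 = dot l l.
Proof.
intros H Hn.
assert (Hd : derivable_pt_lim (fun s => sctden q (f s)) t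
   (0 - (0 * dot q (f t) + 2 * (dot vzero (f t) + dot q l))
    + (0 * dot (f t) (f t) + dot q q * (dot l (f t) + dot (f t) l)))).
{ apply derivable_pt_lim_plus.
  - apply derivable_pt_lim_minus; [apply derivable_pt_lim_const|].
    apply (derivable_pt_lim_mult (fun _ => 2) (fun s => dot q (f s))); [apply derivable_pt_lim_const|].
    apply (deriv_dot (fun _ => q)); [apply vderiv_const | auto].
  - apply (derivable_pt_lim_mult (fun _ => dot q q) (fun s => dot (f s) (f s)));
      [apply derivable_pt_lim_const|].
    now apply deriv_dot. }
pose proof (vderiv_vscale _ _ _ _ _ (derivable_pt_lim_Rinv _ _ _ Hd Hn)
  (vderiv_vsub _ _ _ _ _ H (vderiv_vscale _ _ _ _ _ (deriv_dot _ _ _ _ _ H H) (vderiv_const q t)))) as K.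
eexists; split; [exact K|]; cbv beta.
clear K Hd; set (p := f t) in *.
replace (vadd (vscale (dot l p + dot p l) q) (vscale (dot p p) vzero))
  with (vscale (2 * dot p l) q) by vring.
replace (0 - (0 * dot q p + 2 * (dot vzero p + dot q l)) + (0 * dot p p + dot q q * (dot l p + dot p l)))
  with (2 * (dot q q * dot p l - dot q l)) by (unfold vzero; dring).
set (S := sctden q p) in *.
assert (G : forall k r (V1 V2 : R3), dot (vadd (vscale k V2) (vscale r V1)) (vadd (vscale k V2) (vscale r V1))
  = k ^ 2 * dot V2 V2 + 2 * k * r * dot V1 V2 + r ^ 2 * dot V1 V1) by dring.
rewrite G.
replace (dot (vsub p (vscale (dot p p) q)) (vsub p (vscale (dot p p) q)))
  with (dot p p * S) by (unfold S, sctden; dring).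
replace (dot (vsub l (vscale (2 * dot p l) q)) (vsub p (vscale (dot p p) q)))
  with (dot p l - dot p p * dot q l - 2 * dot p l * dot q p + 2 * dot p l * dot p p * dot q q) by dring.
replace (dot (vsub l (vscale (2 * dot p l) q)) (vsub l (vscale (2 * dot p l) q)))
  with (dot l l - 4 * dot p l * dot q l + 4 * dot p l ^ 2 * dot q q) by dring.
assert (ES : dot q p = (1 + dot q q * dot p p - S) / 2) by (unfold S, sctden; field).
rewrite ES; clearbody S; field; auto.
Qed.

(** * Profile curves *)

(** A class of functions closed under derivation; it yields smoothness without a formula
    for the derivatives of higher order. *)
Inductive elem (B : (R -> R) -> Prop) : (R -> R) -> Prop :=
| elem_base f : B f -> elem B f
| elem_const c : elem B (fun _ => c)
| elem_plus f g : elem B f -> elem B g -> elem B (fun t => f t + g t)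
| elem_mult f g : elem B f -> elem B g -> elem B (fun t => f t * g t)
| elem_inv f : elem B f -> (forall t, f t <> 0) -> elem B (fun t => / f t).

Section Elem.

Variable B : (R -> R) -> Prop.
Hypothesis HB : forall f, B f -> exists f', elem B f' /\ forall t, derivable_pt_lim f t (f' t).

Lemma elem_deriv (f : R -> R) : elem B f ->
  exists f', elem B f' /\ forall t, derivable_pt_lim f t (f' t).
Proof.
induction 1 as [f Hf | c | f g Hf IHf Hg IHg | f g Hf IHf Hg IHg | f Hf IHf N];
  try destruct IHf as (f' & F & DF); try destruct IHg as (g' & G & DG).
- auto.
- exists (fun _ => 0); split; [apply elem_const | intros; apply derivable_pt_lim_const].
- exists (fun t => f' t + g' t); split; [now apply elem_plus|].
  intros t; now apply derivable_pt_lim_plus.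
- exists (fun t => f' t * g t + f t * g' t); split; [apply elem_plus; now apply elem_mult|].
  intros t; now apply derivable_pt_lim_mult.
- exists (fun t => (-1 * f' t) * (/ f t * / f t)); split; [repeat apply elem_mult; auto using elem_const, elem_inv|].
  intros t; replace ((-1 * f' t) * (/ f t * / f t)) with (- f' t / f t ^ 2) by (field; auto).
  now apply derivable_pt_lim_Rinv.
Qed.

(** A derivative inside the class is chosen at each step; iterating the choice gives the sequence
    that [smooth1] asks for. *)
Lemma elem_smooth1 (f : R -> R) : elem B f -> smooth1 f.
Proof.
intros Hf.
set (next := fun s : {g | elem B g} =>
  let (g', H) := constructive_indefinite_description _ (elem_deriv _ (proj2_sig s)) in
  exist (elem B) g' (proj1 H)).
exists (fun n => proj1_sig (Nat.iter n next (exist _ f Hf))); split; [reflexivity|].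
intros n t; simpl; set (s := Nat.iter n next _).
unfold next; destruct (constructive_indefinite_description _ _) as [g' [G DG]]; apply DG.
Qed.

End Elem.

(** The factor (1 + 2 eps)/PI stretches the range of the arctangent to the interval (-eps, 1 +
    eps). *)
Lemma reparametrization (eps : R) : 0 < eps -> exists k, 0 < k /\
  (forall t, - eps < / 2 + k * atan t < 1 + eps) /\
  forall v, 0 <= v <= 1 -> exists t, / 2 + k * atan t = v.
Proof.
intros He; pose proof PI_RGT_0 as Pp.
assert (K : 0 < (1 + 2 * eps) / PI) by (apply Rdiv_lt_0_compat; lra).
assert (KP : (1 + 2 * eps) / PI * (PI / 2) = / 2 + eps) by (field; lra).
exists ((1 + 2 * eps) / PI); set (k := (1 + 2 * eps) / PI) in *; split; auto; split.
- intros t; destruct (atan_bound t) as [B1 B2].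
  apply (Rmult_lt_compat_l k) in B1; auto; apply (Rmult_lt_compat_l k) in B2; auto.
  replace (k * (- PI / 2)) with (- (k * (PI / 2))) in B1 by field; lra.
- intros v Hv; exists (tan ((v - / 2) / k)).
  rewrite atan_tan; [field; lra|].
  split; apply (Rmult_lt_reg_l k); auto.
  + replace (k * ((v - / 2) / k)) with (v - / 2) by (field; lra).
    replace (k * (- PI / 2)) with (- (k * (PI / 2))) by field; lra.
  + replace (k * ((v - / 2) / k)) with (v - / 2) by (field; lra); lra.
Qed.

Lemma continuity_sctden (q : R3) (f : R -> R -> R3) (u v : R) : vcont f u v ->
  continuity_2d_pt (fun s t => sctden q (f s t)) u v.
Proof.
intros H; unfold sctden; apply continuity_2d_pt_plus; [apply continuity_2d_pt_minus|].
- apply continuity_2d_pt_const.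
- apply continuity_2d_pt_mult; [apply continuity_2d_pt_const|].
  apply continuity_dot; [apply vcont_const | exact H].
- apply continuity_2d_pt_mult; [apply continuity_2d_pt_const|].
  now apply continuity_dot.
Qed.

Lemma vcont_sct (q : R3) (f : R -> R -> R3) (u v : R) : vcont f u v -> sctden q (f u v) <> 0 ->
  vcont (fun s t => sct q (f s t)) u v.
Proof.
intros H Hn; apply vcont_vscale.
- apply continuity_2d_pt_inv; [now apply continuity_sctden | exact Hn].
- apply vcont_vsub; [exact H|]; apply vcont_vscale; [now apply continuity_dot | apply vcont_const].
Qed.

Lemma vderiv_comp (f : R -> R3) (g : R -> R) (t : R) (g' : R) (l : R3) :
  derivable_pt_lim g t g' -> vderiv_lim f (g t) l ->
  vderiv_lim (fun s => f (g s)) t (vscale g' l).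
Proof.
intros G (F1 & F2 & F3); repeat split; simpl; rewrite Rmult_comm.
- exact (derivable_pt_lim_comp _ _ _ _ _ G F1).
- exact (derivable_pt_lim_comp _ _ _ _ _ G F2).
- exact (derivable_pt_lim_comp _ _ _ _ _ G F3).
Qed.

Lemma profile_curve (x : R -> R -> R3) (D : nat -> nat -> R -> R -> R3) (o q c : R3) (u : R) :
  jet x D -> (forall v, 0 <= v <= 1 -> sctden q (vsub (x u v) o) <> 0) ->
  (forall v, 0 <= v <= 1 -> D 0%nat 1%nat u v <> vzero) ->
  exists g, smooth_curve g /\ regular_curve g /\
    (forall v, 0 <= v <= 1 -> exists s, g s = vadd c (sct q (vsub (x u v) o))).
Proof.
intros [J0 JD] Hq Hr.
(* The zeros of [H] are the poles of [sct] together with the singular points of the curve. A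
   neighbourhood of [0,1] free of them is enough. *)
set (H := fun s t => sctden q (vsub (D O O s t) o) * dot (D O (S O) s t) (D O (S O) s t)).
assert (HC : forall v, continuity_2d_pt H u v).
{ intros v; apply continuity_2d_pt_mult.
  - apply continuity_sctden, vcont_vsub; [apply JD | apply vcont_const].
  - apply continuity_dot; apply JD. }
assert (HN : forall v, 0 <= v <= 1 -> H u v <> 0).
{ intros v Hv; apply Rmult_integral_contrapositive; split.
  - rewrite J0; auto.
  - now apply Rgt_not_eq, dot_self_pos, Hr. }
destruct (continuity_2d_neq0 _ _ _ (HC 0) (HN 0 ltac:(lra))) as (d0 & P0 & N0).
destruct (continuity_2d_neq0 _ _ _ (HC 1) (HN 1 ltac:(lra))) as (d1 & P1 & N1).
assert (Uu : forall d, 0 < d -> Rabs (u - u) < d) by (intros; now rewrite Rminus_diag, Rabs_R0).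
destruct (reparametrization (Rmin d0 d1)) as (k & Pk & Rg & On); [now apply Rmin_glb_lt|].
pose proof (Rmin_l d0 d1); pose proof (Rmin_r d0 d1).
set (phi := fun t => / 2 + k * atan t).
assert (HP : forall t, H u (phi t) <> 0).
{ intros t; specialize (Rg t); fold (phi t) in Rg.
  destruct (Rlt_le_dec (phi t) 0) as [L | L].
  - apply N0; auto; apply Rabs_def1; lra.
  - destruct (Rlt_le_dec 1 (phi t)) as [L' | L'].
    + apply N1; auto; apply Rabs_def1; lra.
    + apply HN; lra. }
assert (Dphi : forall t, derivable_pt_lim phi t (k * / (1 + t * t))).
{ intros t; replace (k * / (1 + t * t)) with (0 + (0 * atan t + k * / (1 + t ^ 2)))
    by (field; nra).
  apply derivable_pt_lim_plus; [apply derivable_pt_lim_const|].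
  apply (derivable_pt_lim_mult (fun _ => k)); [apply derivable_pt_lim_const|].
  apply derivable_pt_lim_atan. }
(* The identity generates the derivative of [phi]; the coordinates of all v-derivatives along [phi]
   make the class closed under the chain rule. *)
set (B := fun f : R -> R => f = (fun t => t) \/ exists n,
   f = (fun t => c1 (D O n u (phi t))) \/ f = (fun t => c2 (D O n u (phi t))) \/
   f = (fun t => c3 (D O n u (phi t)))).
assert (Bphi : elem B (fun t => k * / (1 + t * t))).
{ apply elem_mult; [apply elem_const|].
  apply elem_inv; [ | intros; nra].
  apply elem_plus; [apply elem_const|].
  apply elem_mult; apply elem_base; now left. }
assert (HB : forall f, B f -> exists f', elem B f' /\ forall t, derivable_pt_lim f t (f' t)).
{ assert (Ch : forall (p : R3 -> R) n, (p = c1 \/ p = c2 \/ p = c3) ->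
     B (fun t => p (D O (S n) u (phi t))) ->
     (forall v, derivable_pt_lim (fun s => p (D O n u s)) v (p (D O (S n) u v))) ->
     exists f', elem B f' /\ forall t, derivable_pt_lim (fun t => p (D O n u (phi t))) t (f' t)).
  { intros p n _ Hb Hd; exists (fun t => p (D O (S n) u (phi t)) * (k * / (1 + t * t))); split.
    - now apply elem_mult; [apply elem_base|].
    - intros t; exact (derivable_pt_lim_comp _ _ _ _ _ (Dphi t) (Hd (phi t))). }
  intros f [-> | (n & [-> | [-> | ->]])].
  - exists (fun _ => 1); split; [apply elem_const | intros; apply derivable_pt_lim_id].
  - apply (Ch c1); auto; [right; exists (S n); tauto | intros; apply JD].
  - apply (Ch c2); auto; [right; exists (S n); tauto | intros; apply JD].
  - apply (Ch c3); auto; [right; exists (S n); tauto | intros; apply JD]. }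
assert (Den : forall t, sctden q (vsub (D O O u (phi t)) o) <> 0).
{ intros t E; apply (HP t); unfold H; rewrite E; ring. }
exists (fun t => vadd c (sct q (vsub (D O O u (phi t)) o))); split; [|split].
- assert (E1 : elem B (fun t => c1 (D O O u (phi t)))) by (apply elem_base; right; exists O; auto).
  assert (E2 : elem B (fun t => c2 (D O O u (phi t)))) by (apply elem_base; right; exists O; auto).
  assert (E3 : elem B (fun t => c3 (D O O u (phi t)))) by (apply elem_base; right; exists O; auto).
  assert (Ed : elem B (fun t => / sctden q (vsub (D O O u (phi t)) o))).
  { apply elem_inv; auto; unfold sctden, vsub, vadd, vscale, dot, Rminus; simpl.
    assert (M : forall f, elem B f -> elem B (fun t => - f t)).
    { intros f Hf; replace (fun t => - f t) with (fun t => -1 * f t)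
        by (apply functional_extensionality; intros; ring).
      apply elem_mult; [apply elem_const | auto]. }
    repeat first [assumption | apply elem_const | apply elem_plus | apply elem_mult | apply M]. }
  unfold smooth_curve, sct; repeat split; apply (elem_smooth1 B HB); simpl;
   repeat first [assumption | apply elem_const | apply elem_plus | apply elem_mult].
- intros t l Hl.
  destruct (vderiv_sct q (fun s => vsub (D O O u (phi s)) o) t _
    (vderiv_vsub _ _ _ _ _ (vderiv_comp (fun s => D O O u s) phi t _ _ (Dphi t) (proj2 (proj2 (JD O O u (phi t)))))
      (vderiv_const o t)) (Den t)) as (m & Hm & Em).
  assert (El : l = vadd vzero m).
  { apply (vderiv_lim_unique _ _ _ _ Hl), vderiv_vadd; [apply vderiv_const | exact Hm]. }
  intros ->; replace m with vzero in Em by (rewrite El at 1; vring).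
  set (w := D 0%nat 1%nat u (phi t)) in *.
  assert (Pw : dot w w <> 0).
  { intros E; apply (HP t); unfold H; fold w; rewrite E; ring. }
  apply Pw; assert (Kt : 0 < k * / (1 + t * t)).
  { apply Rmult_lt_0_compat; auto; apply Rinv_0_lt_compat; nra. }
  set (r := k * / (1 + t * t)) in *.
  replace (dot (vsub (vscale r w) vzero) (vsub (vscale r w) vzero)) with (r ^ 2 * dot w w) in Em
    by (unfold vzero; dring).
  replace (dot vzero vzero) with 0 in Em by (unfold vzero; dring).
  rewrite Rmult_0_l in Em; symmetry in Em; apply Rmult_integral in Em; destruct Em as [Em | Em]; auto.
  exfalso; revert Em; apply pow_nonzero; lra.
- intros v Hv; destruct (On v Hv) as [t Et]; exists t.
  unfold phi; rewrite Et, J0; reflexivity.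
Qed.

Lemma circle_angle (a b : R) : a ^ 2 + b ^ 2 = 1 -> exists th, cos th = a /\ sin th = b.
Proof.
intros H; assert (Ba : -1 <= a <= 1) by nra.
assert (S : b * b = 1 - Rsqr a) by (unfold Rsqr; lra).
destruct (Rle_lt_dec 0 b) as [L | L].
- exists (acos a); rewrite cos_acos, sin_acos by auto; split; auto.
  rewrite <- S; now apply sqrt_square.
- exists (- acos a); rewrite cos_neg, sin_neg, cos_acos, sin_acos by auto; split; auto.
  rewrite <- S; replace (b * b) with ((- b) * (- b)) by ring.
  rewrite sqrt_square by lra; ring.
Qed.

Lemma rotate_between (h w1 w2 : R3) : dot h h = 1 -> dot h w1 = dot h w2 ->
  dot w1 w1 = dot w2 w2 -> exists th, w2 = rotate h th w1.
Proof.
intros Hh E N.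
set (z := dot h w1) in *.
set (p1 := vsub w1 (vscale z h)); set (p2 := vsub w2 (vscale z h)).
assert (H1 : dot h p1 = 0).
{ transitivity (dot h w1 - z * dot h h); [unfold p1; clearbody z; dring | rewrite Hh; unfold z; ring]. }
assert (H2 : dot h p2 = 0).
{ transitivity (dot h w2 - z * dot h h); [unfold p2; clearbody z; dring | rewrite Hh, E; ring]. }
assert (Np : dot p1 p1 = dot p2 p2).
{ transitivity (dot w1 w1 - 2 * z * dot h w1 + z ^ 2 * dot h h); [unfold p1; clearbody z; dring|].
  transitivity (dot w2 w2 - 2 * z * dot h w2 + z ^ 2 * dot h h); [ | unfold p2; clearbody z; dring].
  rewrite N, <- E; unfold z; reflexivity. }
assert (W1 : w1 = vadd (vscale z h) p1) by (unfold p1; vring).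
assert (W2 : w2 = vadd (vscale z h) p2) by (unfold p2; vring).
assert (Rot : forall th, rotate h th w1 =
   vadd (vscale z h) (vadd (vscale (cos th) p1) (vscale (sin th) (cross h p1)))).
{ intros th; unfold rotate; fold z; rewrite W1 at 1 2; vring. }
clearbody p1 p2 z.
destruct (Req_dec (dot p1 p1) 0) as [Z | Z].
- exists 0; rewrite Rot, W2, cos_0, sin_0.
  rewrite Z in Np; symmetry in Np; rewrite (dot_self_eq0 _ Z), (dot_self_eq0 _ Np); vring.
- set (L := dot p1 p1) in *.
  (* Expansion of [p2] in the orthogonal basis [p1], [cross h p1] of the plane orthogonal to the
     axis. Its normalized coefficients are the cosine and sine of the angle. *)
  assert (Id : vscale L p2 = vadd (vscale (dot p1 p2) p1) (vscale (dot (cross h p1) p2) (cross h p1))).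
  { transitivity (vadd (vscale (dot h h * L) p2) (vscale (1 - dot h h) (vscale L p2))); [vring|].
    assert (Q : vscale (dot h h * dot p1 p1) p2 =
      vadd (vadd (vscale (dot h h * dot p1 p2) p1) (vscale (dot (cross h p1) p2) (cross h p1)))
       (vadd (vscale (dot h p1) (vsub (vscale (dot h p1) p2) (vscale (dot h p2) p1)))
         (vadd (vscale (dot h p2 * dot p1 p1) h) (vscale (- (dot h p1 * dot p1 p2)) h)))) by vring.
    unfold L; rewrite Q, H1, H2, Hh; vring. }
  destruct (circle_angle (dot p1 p2 / L) (dot (cross h p1) p2 / L)) as (th & C & Sn).
  + assert (M : dot p1 p2 ^ 2 + dot (cross h p1) p2 ^ 2 = L * L).
    { transitivity (dot (vscale L p2) p2); [rewrite Id; dring|].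
      rewrite Np at 2; dring. }
    transitivity ((dot p1 p2 ^ 2 + dot (cross h p1) p2 ^ 2) / (L * L)); [field; auto|].
    rewrite M; field; auto.
  + exists th; rewrite Rot, W2, C, Sn; f_equal.
    transitivity (vscale (/ L) (vscale L p2)).
    * apply R3_ext; simpl; field; auto.
    * rewrite Id; apply R3_ext; simpl; field; auto.
Qed.

(** * Surfaces of revolution, cones and cylinders *)

Definition mobius_standard (x : R -> R -> R3) : Prop :=
  exists (l : list gsphere) (S : R3 -> Prop), mobius l /\
   (surface_of_revolution S \/ gen_cone S \/ gen_cylinder S) /\
   forall u v, in_square u v -> exists y, S y /\ mob_maps l y (x u v).

Section Standard.

Variables (x : R -> R -> R3) (D : nat -> nat -> R -> R -> R3) (q : R3).
Hypothesis J : jet x D.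
Hypothesis Hreg : forall u v, in_square u v -> cross (D 1 0 u v)%nat (D 0 1 u v)%nat <> vzero.
Let o := x 0 0.
Hypothesis Hq : forall u v, in_square u v -> sctden q (vsub (x u v) o) <> 0.

Let W u v := sct q (vsub (x u v) o).

Lemma vcont_W (u v : R) : in_square u v -> vcont W u v.
Proof.
intros S; apply vcont_sct; [|now apply Hq].
apply vcont_vsub; [|apply vcont_const].
destruct J as [J0 JD], (JD O O u v) as ((C1 & C2 & C3) & _).
split; [|split].
- exact (continuity_2d_pt_ext _ _ _ _ (fun s t => f_equal c1 (J0 s t)) C1).
- exact (continuity_2d_pt_ext _ _ _ _ (fun s t => f_equal c2 (J0 s t)) C2).
- exact (continuity_2d_pt_ext _ _ _ _ (fun s t => f_equal c3 (J0 s t)) C3).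
Qed.

Lemma vcont_W1 (u v : R) : in_square u v -> vcont (fun _ t => W 1 t) u v.
Proof. intros S; apply (vcont_fix1 W), vcont_W; destruct S; unfold in_square; lra. Qed.

Lemma W_profile (c : R3) : exists g, smooth_curve g /\ regular_curve g /\
  (forall v, 0 <= v <= 1 -> exists s, g s = vadd c (W 1 v)).
Proof.
destruct (profile_curve x D o q c 1 J) as (g & G1 & G2 & G3).
- intros v Hv; apply Hq; unfold in_square; lra.
- intros v Hv E; apply (Hreg 1 v); [unfold in_square; lra|]; rewrite E; vring.
- exists g; auto.
Qed.

Lemma standard_intro (S : R3 -> Prop) :
  (surface_of_revolution S \/ gen_cone S \/ gen_cylinder S) ->
  (forall u v, in_square u v -> S (vadd o (W u v))) -> mobius_standard x.
Proof.
intros HS H; destruct (sct_mobius o q) as (l & Hl & K).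
exists l, S; split; [auto | split; auto].
intros u v Suv; exists (vadd o (W u v)); split; auto; apply K; auto.
Qed.

Lemma vclosure (f : R -> R -> R3) (u v : R) : in_square u v -> vcont f u v ->
  (forall s t, 0 < s < 1 -> 0 < t < 1 -> f s t = vzero) -> f u v = vzero.
Proof.
intros S (C1 & C2 & C3) H; apply R3_ext; simpl.
- apply (continuity_2d_eq0_closure (fun s t => c1 (f s t))); auto; intros; now rewrite H.
- apply (continuity_2d_eq0_closure (fun s t => c2 (f s t))); auto; intros; now rewrite H.
- apply (continuity_2d_eq0_closure (fun s t => c3 (f s t))); auto; intros; now rewrite H.
Qed.

(** The profile is the curve u = 1. The hypothesis leaves out the edges u = 0 and v = 0, where the
    pencil gives no formula; they follow by continuity, as in the next two lemmas. *)
Lemma standard_cylinder (e : R3) : e <> vzero ->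
  (forall u v, 0 < u <= 1 -> 0 < v <= 1 -> cross (vsub (W u v) (W 1 v)) e = vzero) ->
  mobius_standard x.
Proof.
intros He H; destruct (W_profile o) as (g & G1 & G2 & G3).
apply (standard_intro (fun y => exists s t, y = vadd (g s) (vscale t e))).
- right; right; exists e, g; repeat split; auto; apply G1 || tauto.
- intros u v S.
  assert (E : cross (vsub (W u v) (W 1 v)) e = vzero).
  { apply (vclosure (fun u v => cross (vsub (W u v) (W 1 v)) e)); auto.
    - apply vcont_cross; [apply vcont_vsub; [now apply vcont_W | now apply vcont_W1] | apply vcont_const].
    - intros; apply H; lra. }
  apply cross_eq0_parallel in E; auto.
  destruct (G3 v) as (s & Es); [apply S|].
  exists s; eexists; rewrite Es.
  transitivity (vadd (vadd o (W 1 v)) (vsub (W u v) (W 1 v))); [vring|].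
  rewrite E at 1; reflexivity.
Qed.

(** The profile has to avoid the apex also at v = 0, because every ruling direction is taken from
    it. *)
Lemma standard_cone (p : R3) : (forall v, 0 <= v <= 1 -> W 1 v <> p) ->
  (forall u v, 0 < u <= 1 -> 0 < v <= 1 -> cross (vsub (W u v) p) (vsub (W 1 v) p) = vzero) ->
  mobius_standard x.
Proof.
intros Hp H; destruct (W_profile (vscale (-1) p)) as (g & G1 & G2 & G3).
apply (standard_intro (fun y => exists s t, y = vadd (vadd o p) (vscale t (g s)))).
- right; left; exists (vadd o p), g; repeat split; auto; apply G1 || tauto.
- intros u v S.
  assert (E : cross (vsub (W u v) p) (vsub (W 1 v) p) = vzero).
  { apply (vclosure (fun u v => cross (vsub (W u v) p) (vsub (W 1 v) p))); auto.
    - apply vcont_cross; (apply vcont_vsub; [first [now apply vcont_W | now apply vcont_W1] | apply vcont_const]).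
    - intros; apply H; lra. }
  apply cross_eq0_parallel in E; [ | apply vsub_neq0, Hp, S].
  destruct (G3 v) as (s & Es); [apply S|].
  exists s; eexists; rewrite Es.
  transitivity (vadd (vadd o p) (vsub (W u v) p)); [vring|].
  rewrite E; replace (vadd (vscale (-1) p) (W 1 v)) with (vsub (W 1 v) p) by vring.
  reflexivity.
Qed.

(** Equal height along [h] and equal distance from a point [p] of the axis place two points on one
    circle of rotation. *)
Lemma standard_revolution (h p : R3) : dot h h = 1 ->
  (forall u v, 0 < u <= 1 -> 0 < v <= 1 -> dot h (W u v) = dot h (W 1 v)) ->
  (forall u v, 0 < u <= 1 -> 0 < v <= 1 ->
     dot (vsub (W u v) p) (vsub (W u v) p) = dot (vsub (W 1 v) p) (vsub (W 1 v) p)) ->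
  mobius_standard x.
Proof.
intros Hh H1 H2; destruct (W_profile o) as (g & G1 & G2 & G3).
apply (standard_intro (fun y => exists th s, y = vadd (vadd o p) (rotate h th (vsub (g s) (vadd o p))))).
- left; exists (vadd o p), h, g; repeat split; auto; apply G1 || tauto.
- intros u v S.
  assert (E1 : dot h (W u v) - dot h (W 1 v) = 0).
  { apply (continuity_2d_eq0_closure (fun u v => dot h (W u v) - dot h (W 1 v))); auto.
    - apply continuity_2d_pt_minus; (apply continuity_dot; [apply vcont_const |
        first [now apply vcont_W | now apply vcont_W1]]).
    - intros; rewrite H1; lra. }
  assert (E2 : dot (vsub (W u v) p) (vsub (W u v) p) - dot (vsub (W 1 v) p) (vsub (W 1 v) p) = 0).
  { apply (continuity_2d_eq0_closure (fun u v =>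
      dot (vsub (W u v) p) (vsub (W u v) p) - dot (vsub (W 1 v) p) (vsub (W 1 v) p))); auto.
    - apply continuity_2d_pt_minus; (apply continuity_dot; (apply vcont_vsub;
        [first [now apply vcont_W | now apply vcont_W1] | apply vcont_const])).
    - intros; rewrite H2; lra. }
  destruct (G3 v) as (s & Es); [apply S|].
  destruct (rotate_between h (vsub (W 1 v) p) (vsub (W u v) p)) as (th & E); auto; try lra.
  + transitivity (dot h (W 1 v) - dot h p); [dring|].
    transitivity (dot h (W u v) - dot h p); [lra | dring].
  + exists th, s; rewrite Es.
    replace (vsub (vadd o (W 1 v)) (vadd o p)) with (vsub (W 1 v) p) by vring.
    rewrite <- E; vring.
Qed.

End Standard.

(** * The three types of pencil *)

Lemma unit_perp (e : R3) : dot e e = 1 -> exists f, dot f f = 1 /\ dot e f = 0.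
Proof.
intros He.
destruct (exists_perp e) as (n & En & Nn); apply dot_self_pos in Nn.
assert (P : 0 < sqrt (dot n n)) by now apply sqrt_lt_R0.
assert (S : dot n n = sqrt (dot n n) * sqrt (dot n n)) by (symmetry; apply sqrt_sqrt; lra).
set (r := sqrt (dot n n)) in *.
exists (vscale (/ r) n); split.
- transitivity (/ r * / r * dot n n); [clearbody r; dring | rewrite S; field; lra].
- transitivity (/ r * dot n e); [clearbody r; dring | rewrite En; ring].
Qed.

(** The curves u and 1 are both inverses of b in spheres of the pencil, so they differ by a product
    of two such inversions. With the pole [q] sent to infinity, this product becomes a homothety for
    c < 0, a translation for c = 0 and a rotation for c > 0. *)
Lemma axial_mobius_standard (x : R -> R -> R3) (D : nat -> nat -> R -> R -> R3) :
  jet x D -> (forall u v, in_square u v -> cross (D 1 0 u v)%nat (D 0 1 u v)%nat <> vzero) ->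
  circular_patch x -> axial x -> mobius_standard x.
Proof.
intros J Hreg P (m & e & c & al & He & Ha & Hb).
set (o := x 0 0).
assert (Nx : forall u v, in_square u v -> u <> 0 \/ v <> 0 -> vsub (x u v) o <> vzero).
{ intros u v S H; apply vsub_neq0, patch_neq; auto; unfold in_square; lra. }
(* the pole [q] of the special conformal transformation has to avoid the inverted patch *)
assert (Den : forall q,
  (forall u, 0 < u <= 1 -> vscale (al u) e <> vsub q m) ->
  (forall v, 0 < v <= 1 -> vsub (invpt x 0 0 0 v) m <> vsub q m) ->
  (forall u v, 0 < u <= 1 -> 0 < v <= 1 -> vsub (invpt x 0 0 u v) m <> vsub q m) ->
  forall u v, in_square u v -> sctden q (vsub (x u v) o) <> 0).
{ intros q A B C u v S.
  destruct (Req_dec u 0) as [U | U]; [destruct (Req_dec v 0) as [V | V]|].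
  - subst; replace (vsub (x 0 0) o) with vzero by (unfold o; vring).
    unfold sctden, vzero, dot; simpl; lra.
  - rewrite sctden_inv0 by (apply Nx; auto).
    apply Rgt_not_eq, Rmult_lt_0_compat; [apply dot_self_pos, Nx; auto|].
    apply dot_self_pos, vsub_neq0; intros E; subst u.
    apply (B v); [destruct S; lra|]; rewrite <- E; reflexivity.
  - rewrite sctden_inv0 by (apply Nx; auto).
    apply Rgt_not_eq, Rmult_lt_0_compat; [apply dot_self_pos, Nx; auto|].
    apply dot_self_pos, vsub_neq0; intros E.
    destruct S as [Su Sv]; destruct (Req_dec v 0) as [-> | V].
    + apply (A u); [lra|]; rewrite <- E.
      change (inv0 (vsub (x u 0) o)) with (invpt x 0 0 u 0).
      destruct (Ha u) as [-> _]; [lra | vring].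
    + apply (C u v); [lra | lra|]; rewrite <- E; reflexivity. }
assert (Val : forall q u v, in_square u v -> u <> 0 \/ v <> 0 ->
   sctden q (vsub (x u v) o) <> 0 ->
   sct q (vsub (x u v) o) = inv0 (vsub (vsub (invpt x 0 0 u v) m) (vsub q m))).
{ intros q u v S H Hd; rewrite sct_inv0; [ | now apply Nx | ].
  - f_equal; change (inv0 (vsub (x u v) o)) with (invpt x 0 0 u v); vring.
  - intros E; apply Hd; rewrite sctden_inv0 by now apply Nx.
    rewrite E; replace (vsub q q) with vzero by vring; unfold vzero, dot; simpl; ring. }
assert (Sq : forall u v, 0 < u <= 1 -> 0 < v <= 1 -> in_square u v) by (intros; unfold in_square; lra).
assert (Ne : e <> vzero) by (apply dot_pos_neq0; lra).
destruct (Rtotal_order c 0) as [Hc | [-> | Hc]].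
- (* the pencil has two limit points [m + k e] and [m - k e]; the latter becomes the apex *)
  set (k := sqrt (- c)).
  assert (Pk : 0 < k) by (apply sqrt_lt_R0; lra).
  assert (Kc : k * k = - c) by (apply sqrt_sqrt; lra); clearbody k.
  set (q := vadd m (vscale k e)).
  assert (Eq : vsub q m = vscale k e) by (unfold q; vring).
  assert (Nal : forall u, 0 < u <= 1 -> al u <> k /\ al u <> - k).
  { intros u Hu; destruct (Ha u Hu) as [_ A]; split; intros E; rewrite E in A; nra. }
  assert (NY : forall u v, 0 < u <= 1 -> 0 < v <= 1 -> vsub (invpt x 0 0 u v) m <> vsub q m).
  { intros u v Hu Hv E; rewrite Eq in E; destruct (Hb v Hv) as (B1 & B2 & K).
    destruct (K u Hu) as (t & s & Ht & Ey & En); rewrite E in En.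
    set (b := vsub (invpt x 0 0 0 v) m) in *.
    assert (Eb : t * dot b b = 0).
    { transitivity (dot (vsub (vadd (vscale t b) (vscale s e)) (vscale k e)) b + (k - s) * dot e b);
        [dring | rewrite <- Ey, E, B1].
      replace (vsub (vscale k e) (vscale k e)) with vzero by vring; unfold vzero; dring. }
    replace (dot (vscale k e) (vscale k e)) with (k * k * dot e e) in En by dring.
    rewrite He, Kc in En; nra. }
  assert (Hq : forall u v, in_square u v -> sctden q (vsub (x u v) o) <> 0).
  { apply Den; auto.
    - intros u Hu E; rewrite Eq in E; apply (proj1 (Nal u Hu)).
      apply (f_equal (dot e)) in E.
      replace (dot e (vscale (al u) e)) with (al u * dot e e) in E by dring.
      replace (dot e (vscale k e)) with (k * dot e e) in E by dring.
      rewrite He in E; lra.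
    - intros v Hv E; rewrite Eq in E; destruct (Hb v Hv) as (B1 & _); rewrite E in B1.
      replace (dot e (vscale k e)) with (k * dot e e) in B1 by dring.
      rewrite He in B1; lra. }
  (* The image of the other limit point: [inv0] of -k e - k e. *)
  set (p := vscale (- / (2 * k)) e).
  assert (WV : forall u v, 0 < u <= 1 -> 0 < v <= 1 -> let b := vsub (invpt x 0 0 0 v) m in
    exists r, r <> 0 /\ vsub (sct q (vsub (x u v) o)) p =
      vscale r (vadd (vscale (2 * k) b) (vscale (dot b b + c) e))).
  { intros u v Hu Hv b; rewrite Val; [ | auto | left; lra | apply Hq; auto].
    pose proof (vsub_neq0 _ _ (NY u v Hu Hv)) as N; apply dot_self_pos in N.
    rewrite Eq in *; destruct (Hb v Hv) as (B1 & B2 & K).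
    destruct (K u Hu) as (t & s & Ht & Ey & En); fold b in B1, B2, Ey, En.
    set (y := vsub (invpt x 0 0 u v) m) in *.
    exists (t / (2 * k * dot (vsub y (vscale k e)) (vsub y (vscale k e)))); split.
    - apply Rgt_not_eq, Rdiv_lt_0_compat; nra.
    - unfold inv0, p; set (M := dot (vsub y (vscale k e)) (vsub y (vscale k e))) in *.
      assert (EM : M = t * (dot b b + c) - 2 * k * s - 2 * c).
      { transitivity (dot y y - 2 * k * dot e y + k * k * dot e e); [unfold M; dring|].
        rewrite He, Kc; replace (dot e y) with s.
        - lra.
        - rewrite Ey; transitivity (t * dot e b + s * dot e e); [rewrite B1, He; ring | dring]. }
      clearbody M y.
      transitivity (vscale (/ (2 * k * M)) (vadd (vscale (2 * k) (vsub y (vscale k e))) (vscale M e))).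
      + apply R3_ext; simpl; field; lra.
      + transitivity (vscale (/ (2 * k * M)) (vscale t (vadd (vscale (2 * k) b) (vscale (dot b b + c) e)))).
        * f_equal; rewrite EM, Ey; replace c with (- (k * k)) by lra; clear; clearbody b; vring.
        * unfold Rdiv; vring. }
  apply (standard_cone x D q J Hreg Hq p).
  + intros v Hv; destruct (Req_dec v 0) as [-> | V].
    * rewrite Val; [ | unfold in_square; lra | lra | apply Hq; unfold in_square; lra].
      destruct (Ha 1) as [-> _]; [lra|]; destruct (Nal 1) as [N1 N2]; [lra|].
      rewrite Eq; replace (vsub (vsub (vadd m (vscale (al 1) e)) m) (vscale k e))
        with (vscale (al 1 - k) e) by vring.
      unfold inv0; replace (dot (vscale (al 1 - k) e) (vscale (al 1 - k) e))
        with ((al 1 - k) ^ 2 * dot e e) by dring.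
      rewrite He; intros E; apply (f_equal (dot e)) in E; unfold p in E.
      replace (dot e (vscale (- / (2 * k)) e)) with (- / (2 * k) * dot e e) in E by dring.
      replace (dot e (vscale (/ ((al 1 - k) ^ 2 * 1)) (vscale (al 1 - k) e)))
        with (/ ((al 1 - k) ^ 2 * 1) * (al 1 - k) * dot e e) in E by dring.
      rewrite He in E; apply N2.
      apply (f_equal (fun z => z * (2 * k * (al 1 - k)))) in E.
      field_simplify in E; lra.
    * destruct (WV 1 v) as (r & Hr & E); try lra; cbv zeta in E.
      destruct (Hb v) as (B1 & _); [lra|]; set (b := vsub (invpt x 0 0 0 v) m) in *.
      fold o; intros F; rewrite F in E; replace (vsub p p) with vzero in E by vring.
      apply (f_equal (fun z => dot z z)) in E.
      replace (dot vzero vzero) with 0 in E by (unfold vzero; dring).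
      (* The squared length of the ruling direction; since k^2 = -c, it equals (|b|^2 - c)^2, which
         is positive. *)
      assert (E' : 0 = r ^ 2 * (4 * (k * k) * dot b b + (dot b b + c) ^ 2)).
      { rewrite E at 1.
        transitivity (r ^ 2 * (4 * (k * k) * dot b b + 4 * k * (dot b b + c) * dot e b + (dot b b + c) ^ 2 * dot e e));
          [clearbody b; dring | rewrite B1, He; ring]. }
      rewrite Kc in E'; replace (4 * - c * dot b b + (dot b b + c) ^ 2) with ((dot b b - c) ^ 2) in E' by ring.
      pose proof (dot_self_ge0 b).
      symmetry in E'; apply Rmult_integral in E'; destruct E' as [E' | E'];
        revert E'; apply pow_nonzero; lra.
  + intros u v Hu Hv; destruct (WV u v Hu Hv) as (r & _ & E); destruct (WV 1 v) as (r1 & _ & E1); try lra.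
    fold o; rewrite E, E1; vring.
- (* all spheres of the pencil touch at [m] *)
  assert (Eq : vsub m m = vzero) by vring.
  assert (By : forall u v, 0 < u <= 1 -> 0 < v <= 1 -> vsub (invpt x 0 0 u v) m <> vzero).
  { intros u v Hu Hv; destruct (Hb v Hv) as (B1 & B2 & K).
    destruct (K u Hu) as (t & s & Ht & Ey & En); apply dot_pos_neq0; nra. }
  assert (Hq : forall u v, in_square u v -> sctden m (vsub (x u v) o) <> 0).
  { apply Den; rewrite Eq; auto.
    - intros u Hu; destruct (Ha u Hu) as [_ A]; apply dot_pos_neq0.
      replace (dot _ _) with (al u ^ 2 * dot e e) by dring; rewrite He; lra.
    - intros v Hv; destruct (Hb v Hv) as (B1 & B2 & _); apply dot_pos_neq0; lra. }
  (* The cross product with [e] removes the component of y along [e]. The factor t of the rest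
     cancels because |y|^2 = t |b|^2, so no u is left. *)
  assert (WV : forall u v, 0 < u <= 1 -> 0 < v <= 1 -> let b := vsub (invpt x 0 0 0 v) m in
    cross (sct m (vsub (x u v) o)) e = vscale (/ dot b b) (cross b e)).
  { intros u v Hu Hv b; rewrite Val; [ | auto | left; lra | apply Hq; auto].
    rewrite Eq; replace (vsub (vsub (invpt x 0 0 u v) m) vzero) with (vsub (invpt x 0 0 u v) m) by vring.
    destruct (Hb v Hv) as (B1 & B2 & K).
    destruct (K u Hu) as (t & s & Ht & Ey & En); fold b in B1, B2, Ey, En.
    unfold inv0; rewrite !Rplus_0_r in En; rewrite En, Ey.
    transitivity (vscale (/ (t * dot b b) * t) (cross b e)); [clearbody b; vring|].
    f_equal; field; lra. }
  apply (standard_cylinder x D m J Hreg Hq e Ne).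
  intros u v Hu Hv; fold o.
  replace (cross (vsub (sct m (vsub (x u v) o)) (sct m (vsub (x 1 v) o))) e)
    with (vsub (cross (sct m (vsub (x u v) o)) e) (cross (sct m (vsub (x 1 v) o)) e)) by vring.
  rewrite !WV by lra; vring.
- (* all spheres of the pencil pass through a circle with center [m] and axis direction [e],
     one point of which is sent to infinity *)
  destruct (unit_perp e He) as (f & Hf & Hef).
  set (k := sqrt c).
  assert (Pk : 0 < k) by (apply sqrt_lt_R0; lra).
  assert (Kc : k * k = c) by (apply sqrt_sqrt; lra); clearbody k.
  set (q := vadd m (vscale k f)).
  assert (Eq : vsub q m = vscale k f) by (unfold q; vring).
  assert (NB : forall v, 0 < v <= 1 -> vsub (invpt x 0 0 0 v) m <> vscale k f).
  { intros v Hv E; destruct (Hb v Hv) as (_ & B2 & _); rewrite E in B2.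
    replace (dot (vscale k f) (vscale k f)) with (k * k * dot f f) in B2 by dring.
    rewrite Hf in B2; lra. }
  (* As [f] is orthogonal to [e], both |y|^2 + c and y.f carry the factor t; so does the squared
     distance to the pole, and t cancels after inversion. *)
  assert (Dist : forall u v, 0 < u <= 1 -> 0 < v <= 1 ->
    let b := vsub (invpt x 0 0 0 v) m in let y := vsub (invpt x 0 0 u v) m in
    exists t s, 0 < t /\ y = vadd (vscale t b) (vscale s e) /\
      dot (vsub y (vscale k f)) (vsub y (vscale k f)) = t * dot (vsub b (vscale k f)) (vsub b (vscale k f))).
  { intros u v Hu Hv b y; destruct (Hb v Hv) as (B1 & _ & K).
    destruct (K u Hu) as (t & s & Ht & Ey & En); fold b in B1, Ey, En; fold y in Ey, En.
    exists t, s; repeat split; auto.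
    transitivity (dot y y + k * k * dot f f - 2 * k * dot f y); [clearbody y; dring|].
    rewrite Hf, Kc; replace (dot f y) with (t * dot f b).
    - transitivity (t * (dot b b + k * k * dot f f - 2 * k * dot f b)); [ | clearbody b; dring].
      rewrite Hf, Kc; lra.
    - rewrite Ey; transitivity (t * dot f b + s * dot e f); [rewrite Hef; ring | clearbody b; dring]. }
  assert (NY : forall u v, 0 < u <= 1 -> 0 < v <= 1 -> vsub (invpt x 0 0 u v) m <> vsub q m).
  { intros u v Hu Hv E; rewrite Eq in E; destruct (Dist u v Hu Hv) as (t & s & Ht & _ & K).
    cbv zeta in K; rewrite E in K.
    pose proof (dot_self_pos _ (vsub_neq0 _ _ (NB v Hv))).
    replace (vsub (vscale k f) (vscale k f)) with vzero in K by vring.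
    replace (dot vzero vzero) with 0 in K by (unfold vzero; dring); nra. }
  assert (Hq : forall u v, in_square u v -> sctden q (vsub (x u v) o) <> 0).
  { apply Den; auto; rewrite Eq; auto.
    intros u Hu E; apply (f_equal (dot f)) in E.
    replace (dot f (vscale (al u) e)) with (al u * dot e f) in E by dring.
    replace (dot f (vscale k f)) with (k * dot f f) in E by dring.
    rewrite Hef, Hf in E; lra. }
  (* The common circle becomes the axis: [h] is its tangent direction at the pole k f, and [p] is
     the image of the antipodal point -k f. *)
  set (h := cross e f); set (p := vscale (- / (2 * k)) f).
  assert (Hh : dot h h = 1).
  { transitivity (dot e e * dot f f - dot e f ^ 2); [unfold h; dring | rewrite He, Hf, Hef; ring]. }
  assert (WV : forall u v, 0 < u <= 1 -> 0 < v <= 1 -> let b := vsub (invpt x 0 0 0 v) m in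
    let M := dot (vsub b (vscale k f)) (vsub b (vscale k f)) in
    let w := sct q (vsub (x u v) o) in
    dot h w = dot h b / M /\
    dot (vsub w p) (vsub w p) = dot f b / (k * M) + / (4 * k ^ 2)).
  { intros u v Hu Hv b M w; unfold w; rewrite Val; [ | auto | left; lra | apply Hq; auto].
    rewrite Eq; destruct (Dist u v Hu Hv) as (t & s & Ht & Ey & K).
    fold b in Ey, K; set (y := vsub (invpt x 0 0 u v) m) in *; fold M in K.
    assert (PM : 0 < M) by exact (dot_self_pos _ (vsub_neq0 _ _ (NB v Hv))).
    assert (Nz : vsub y (vscale k f) <> vzero).
    { apply dot_pos_neq0; rewrite K; nra. }
    assert (Fy : dot f y = t * dot f b).
    { rewrite Ey; transitivity (t * dot f b + s * dot e f); [clearbody b; dring | rewrite Hef; ring]. }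
    split.
    - rewrite dot_inv0_l, K.
      replace (dot h (vsub y (vscale k f))) with (t * dot h b); [field; lra|].
      rewrite Ey; unfold h; clearbody b; dring.
    - transitivity (dot (inv0 (vsub y (vscale k f))) (inv0 (vsub y (vscale k f)))
        + / k * dot f (inv0 (vsub y (vscale k f))) + / (2 * k) * / (2 * k) * dot f f).
      + set (z := inv0 _); unfold p.
        replace (/ k) with (2 * / (2 * k)) by (field; lra); set (k2 := / (2 * k)); clearbody z k2; dring.
      + rewrite inv0_norm, dot_inv0_l, K, Hf by exact Nz.
        replace (dot f (vsub y (vscale k f))) with (dot f y - k * dot f f) by (clearbody y; dring).
        rewrite Fy, Hf; field; lra. }
  apply (standard_revolution x D q J Hreg Hq h p Hh); intros u v Hu Hv; fold o.
  + destruct (WV u v Hu Hv) as [-> _]; destruct (WV 1 v) as [-> _]; auto; lra.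
  + destruct (WV u v Hu Hv) as [_ ->]; destruct (WV 1 v) as [_ ->]; auto; lra.
Qed.

Lemma jet_swap (x : R -> R -> R3) (D : nat -> nat -> R -> R -> R3) :
  jet x D -> jet (fun u v => x v u) (fun i j u v => D j i v u).
Proof.
intros [J0 JD]; split; [intros; apply J0|].
intros i j u v; destruct (JD j i v u) as (C & L1 & L2).
split; [exact (vcont_swap _ _ _ C) | split; [exact L2 | exact L1]].
Qed.

Theorem theorem6p8 (x : R -> R -> R3)
  (Hsmooth : smooth_surface x)
  (Hreg : forall u v, in_square u v -> regular_at x u v)
  (Hgen : generic_patch x)
  (Hcirc : forall u0 u1 v0 v1, 0 <= u0 -> u0 < u1 -> u1 <= 1 ->
             0 <= v0 -> v0 < v1 -> v1 <= 1 ->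
             concyclic4 (x u0 v0) (x u1 v0) (x u1 v1) (x u0 v1)) :
  (* parameter lines are principal curvature lines *)
  (forall u v, in_square u v -> u_principal x u v /\ v_principal x u v) /\
  (* Moebius image of a piece of a surface of revolution, cone or cylinder *)
  (exists (l : list gsphere) (S : R3 -> Prop), mobius l /\
     (surface_of_revolution S \/ gen_cone S \/ gen_cylinder S) /\
     forall u v, in_square u v -> exists y, S y /\ mob_maps l y (x u v)) /\
  (* curvature lines of the same family are related by an inversion *)
  (forall v0 v1, 0 <= v0 -> v0 < v1 -> v1 <= 1 ->
     exists g, valid_gs g /\ forall u, 0 <= u <= 1 ->
       gs_defined g (x u v0) /\ gs_apply g (x u v0) = x u v1) /\
  (forall u0 u1, 0 <= u0 -> u0 < u1 -> u1 <= 1 ->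
     exists g, valid_gs g /\ forall v, 0 <= v <= 1 ->
       gs_defined g (x u0 v) /\ gs_apply g (x u0 v) = x u1 v).
Proof.
destruct (smooth_surface_jet x Hsmooth) as [D J].
assert (Rg : forall u v, in_square u v -> cross (D 1 0 u v)%nat (D 0 1 u v)%nat <> vzero).
{ intros u v S; rewrite <- (jet_pdu x D J), <- (jet_pdv x D J); now apply Hreg. }
assert (P : circular_patch x) by (apply (regular_circular_patch x D); auto; apply Hgen).
assert (P' := circular_patch_swap x P).
split; [|split; [|split]].
- intros u v S; now apply (parameter_lines_principal x D).
- destruct (axial_or_swap x P) as [A | A].
  + exact (axial_mobius_standard x D J Rg P A).
  + destruct (axial_mobius_standard _ _ (jet_swap x D J)) with (3 := A) as (l & S & L & T & K); auto.
    * intros u v [Su Sv] E; apply (Rg v u); [split; auto|].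
      replace (cross _ _) with (vscale (-1) (cross (D 0%nat 1%nat v u) (D 1%nat 0%nat v u))) by vring.
      rewrite E; vring.
    * exists l, S; repeat split; auto; intros u v [Su Sv]; apply K; split; auto.
- intros; now apply parameter_lines_inverse.
- intros; now apply (parameter_lines_inverse (fun u v => x v u)).
Qed.
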